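(* There is an algorithm that, given an instance of Weighted Gerrymandering (W-GM) on an arbitrary graph together with a tie-breaking rule $\eta$, decides the instance (under $\eta$) in time $2^n (n+m)^{\mathcal{O}(1)}$, where $n=|V(G)|$ and $m=|\mathcal{C}|$.
   Context: Weighted Gerrymandering (W-GM): the input is a graph $G$ on $n$ vertices (voters), a set $\mathcal{C}$ of $m$ candidates, for each voter $v\in V(G)$ a weight function $w_v\colon\mathcal{C}\to\mathbb{Z}^+$, a distinguished candidate $p\in\mathcal{C}$, and a positive integer $k$. A district is a nonempty set $U\subseteq V(G)$ with $G[U]$ connected. A tie-breaking rule $\eta$ assigns to every district $U$ a single candidate $\eta(U)\in\arg\max_{q\in\mathcal{C}}\sum_{v\in U} w_v(q)$, called the winner of $U$. The question is whether $V(G)$ can be partitioned into $k$ pairwise disjoint districts such that $p$ wins strictly more of these districts than any other candidate. *)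

(* Defs.v *)
From mathcomp Require Import all_boot.

Set Implicit Arguments.
Unset Strict Implicit.
Unset Printing Implicit Defensive.

Record wgm (n m : nat) := Wgm {
  adj : rel 'I_n;
  adj_sym : symmetric adj;
  adj_irr : irreflexive adj;
  weight : 'I_n -> 'I_m -> nat;
  weight_gt0 : forall v q, 0 < weight v q;
  favourite : 'I_m;
  ndist : nat;
  ndist_gt0 : 0 < ndist
}.

Section Problem.
Variables (n m : nat) (I : wgm n m).

Definition induced (U : {set 'I_n}) : rel 'I_n :=
  [rel x y | [&& x \in U, y \in U & adj I x y]].

Definition district (U : {set 'I_n}) : bool :=
  (U != set0) && [forall x in U, forall y in U, connect (induced U) x y].

Definition score (U : {set 'I_n}) (q : 'I_m) : nat :=
  \sum_(v in U) weight I v q.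

(* Nothing is assumed about the value of [eta] on a set that is not a
   district. *)
Definition tie_breaking (eta : {set 'I_n} -> 'I_m) : Prop :=
  forall U, district U -> forall q, score U q <= score U (eta U).

Definition wins (eta : {set 'I_n} -> 'I_m) (P : {set {set 'I_n}}) (q : 'I_m) :
  nat := #|[set U in P | eta U == q]|.

Definition wgm_yes (eta : {set 'I_n} -> 'I_m) : bool :=
  [exists P : {set {set 'I_n}},
    [&& partition P [set: 'I_n], #|P| == ndist I,
        [forall U in P, district U]
      & [forall q, (q != favourite I) ==>
                   (wins eta P q < wins eta P (favourite I))]]].

End Problem.

(* Programs of a word RAM with an oracle: registers and memory cells, both
   indexed by nat, hold words of [w] bits.  A program is a fixed syntactic
   object: it mentions finitely many registers, and it does not depend on [w],
   on the oracle or on the input. *)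
Inductive binop := OpAdd | OpSub | OpMul | OpDiv | OpMod | OpEq | OpLt.

Inductive cmd :=
| CSkip
| CConst of nat & nat             (* r_i := constant *)
| COp of binop & nat & nat & nat  (* r_i := r_j op r_k *)
| CLoad of nat & nat              (* r_i := mem[r_j] *)
| CStore of nat & nat             (* mem[r_i] := r_j *)
| CQuery of nat & nat             (* r_i := oracle(r_j) *)
| CSeq of cmd & cmd
| CIf of nat & cmd & cmd          (* branches on r_i <> 0 *)
| CWhile of nat & cmd.            (* loops as long as r_i <> 0 *)

Record state := State { reg : nat -> nat; mem : nat -> nat }.

Definition upd (f : nat -> nat) (i x : nat) : nat -> nat :=
  fun j => if j == i then x else f j.

Definition set_reg (s : state) (i x : nat) : state :=
  State (upd (reg s) i x) (mem s).

Definition set_mem (s : state) (a x : nat) : state :=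
  State (reg s) (upd (mem s) a x).

Section Semantics.
Variables (w : nat) (oracle : nat -> nat).

(* On words, i.e. for [x, y < 2 ^ w], the result is again a word; subtraction
   wraps around. *)
Definition eval_op (o : binop) (x y : nat) : nat :=
  match o with
  | OpAdd => (x + y) %% 2 ^ w
  | OpSub => (x + (2 ^ w - y)) %% 2 ^ w
  | OpMul => (x * y) %% 2 ^ w
  | OpDiv => x %/ y
  | OpMod => x %% y
  | OpEq => x == y
  | OpLt => x < y
  end.

(* [exec c s t s']: started in [s], [c] halts in [s'] after [t] unit-cost
   steps; each elementary command and each evaluation of a test is a step.
   The relation is functional in [(t, s')], and a diverging run has no
   derivation. *)
Inductive exec : cmd -> state -> nat -> state -> Prop :=
| ESkip s : exec CSkip s 1 s
| EConst i x s : exec (CConst i x) s 1 (set_reg s i (x %% 2 ^ w))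
| EOp o i j k s :
    exec (COp o i j k) s 1 (set_reg s i (eval_op o (reg s j) (reg s k)))
| ELoad i j s : exec (CLoad i j) s 1 (set_reg s i (mem s (reg s j)))
| EStore i j s : exec (CStore i j) s 1 (set_mem s (reg s i) (reg s j))
| EQuery i j s : exec (CQuery i j) s 1 (set_reg s i (oracle (reg s j)))
| ESeq c1 c2 s1 s2 s3 t1 t2 :
    exec c1 s1 t1 s2 -> exec c2 s2 t2 s3 -> exec (CSeq c1 c2) s1 (t1 + t2) s3
| EIfTrue i c1 c2 s t s' :
    reg s i != 0 -> exec c1 s t s' -> exec (CIf i c1 c2) s t.+1 s'
| EIfFalse i c1 c2 s t s' :
    reg s i = 0 -> exec c2 s t s' -> exec (CIf i c1 c2) s t.+1 s'
| EWhileTrue i c s1 s2 s3 t1 t2 :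
    reg s1 i != 0 -> exec c s1 t1 s2 -> exec (CWhile i c) s2 t2 s3 ->
    exec (CWhile i c) s1 (t1 + t2).+1 s3
| EWhileFalse i c s : reg s i = 0 -> exec (CWhile i c) s 1 s.

End Semantics.

Section Encoding.
Variables (n m : nat) (I : wgm n m).

(* n, m, p, k, the adjacency matrix and the weights, both in row-major order. *)
Definition input_seq : seq nat :=
  [:: n; m; nat_of_ord (favourite I); ndist I]
  ++ [seq nat_of_bool (adj I u v) | u <- enum 'I_n, v <- enum 'I_n]
  ++ [seq weight I v q | v <- enum 'I_n, q <- enum 'I_m].

Definition input_state : state :=
  State (fun=> 0) (fun a => nth 0 input_seq a).

(* A set of vertices is presented to the oracle as the word whose v-th bit is
   1 exactly when v belongs to the set. *)
Definition set_of_word (x : nat) : {set 'I_n} :=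
  [set v : 'I_n | odd (x %/ 2 ^ v)].

Definition eta_oracle (eta : {set 'I_n} -> 'I_m) : nat -> nat :=
  fun x => eta (set_of_word x).

End Encoding.

(* Register 0 holds the answer. *)
Definition decides_within (prog : cmd) (w n m : nat) (I : wgm n m)
    (eta : {set 'I_n} -> 'I_m) (T : nat) : Prop :=
  exists t s, [/\ exec w (eta_oracle eta) prog (input_state I) t s,
                  t <= T & reg s 0 = nat_of_bool (wgm_yes I eta)].

(* The usual word-RAM convention: a word can hold each input number and
   address [T] memory cells. *)
Definition word_size_ok (w n m : nat) (I : wgm n m) (T : nat) : Prop :=
  all (fun x => x < 2 ^ w) (input_seq I) /\ T <= 2 ^ w.

(* Main.v *)
From mathcomp Require Import all_boot zify.
Require Import Defs.

(** The weights only enter through the winners, which the oracle reveals.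
    Guess the number [a] of districts won by the favourite.  Reserve [n]
    consecutive slots for each candidate; the first [a] slots of the favourite
    must be filled with a district that it wins, and the first [a - 1] slots of
    any other candidate may be.  Whether a set splits into [j] districts that
    fill the slots below [s] obeys a recurrence in [s] whose only expensive part
    is a subset convolution of two 0/1 families.  That is computed by counting
    pairs [(A, B)] with [#|A| + #|B| = r] and [A :|: B = S], through ranked zeta
    and Moebius transforms.  All intermediate numbers are cardinals taken
    modulo [2 ^ w], and the last one is at most [2 ^ n < 2 ^ w], so wrapping
    around does no harm.  Every quantity is a cell of one write-once table,
    filled by a single loop that evaluates a fixed expression. *)

Set Implicit Arguments.
Unset Strict Implicit.
Unset Printing Implicit Defensive.

(** * Expressions and their compilation *)

(** Enumerating the subsets of every set would cost about [3 ^ n] per slot, which is why the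
    splitting of a set is left to transforms. These see only unions, and a union may come from
    overlapping parts; taking [r = #|S|] leaves just the pairs whose sizes add up to that of their
    union, that is, the disjoint ones. In such a pair [A] is the complement of [B] in [S], whence
    the bound [2 ^ n] on their number.

    Slots turn a bound on numbers of wins into one decision per slot. A partition has at most [n]
    districts, so [n] slots per candidate suffice, and as the slots of a candidate are
    interchangeable, nothing has to be remembered about the districts that occupy them.

    Connectivity needs no graph search: a connected set with at least two vertices stays connected
    after the deletion of a suitable vertex, so districts are recognised from smaller sets and form
    the bottom layer of the table. *)

(* [Let e f] and [Fold e f] give to [f] the environment levels of the variables
   that they bind.  [Fold] always iterates [D] times, where [D] is the variable
   of level 0, so that [cost] bounds the running time of an expression without
   looking at values. *)
Inductive exp :=
| Var of nat
| Cst of nat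
| Bin of binop & exp & exp
| Ld of exp
| Qry of exp
| If of exp & exp & exp
| Let of exp & (nat -> exp)
| Fold of exp & (nat -> nat -> exp).

Fixpoint eval (w D : nat) (oracle mu : nat -> nat) (rho : seq nat) (e : exp) :
    nat :=
  let ev := eval w D oracle mu in
  match e with
  | Var i => nth 0 rho i
  | Cst x => x %% 2 ^ w
  | Bin o e1 e2 => eval_op w o (ev rho e1) (ev rho e2)
  | Ld e1 => mu (ev rho e1)
  | Qry e1 => oracle (ev rho e1)
  | If e0 e1 e2 => if ev rho e0 != 0 then ev rho e1 else ev rho e2
  | Let e1 f => ev (rcons rho (ev rho e1)) (f (size rho))
  | Fold e1 f =>
      iteri D (fun x acc =>
        ev (rcons (rcons rho x) acc) (f (size rho) (size rho).+1)) (ev rho e1)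
  end.

(** Variables get the even registers and temporaries the odd ones, so that neither stack has to be
    bounded in advance. *)
Definition vreg (i : nat) := i.*2.
Definition treg (d : nat) := d.*2.+1.

(* [x %% 0 = x], so this copies register [j], whatever its value. *)
Definition move (i j z : nat) := CSeq (CConst z 0) (COp OpMod i j z).

Definition seqs := foldr CSeq CSkip.

(** [b] is the number of variables in scope and [d] the depth of the temporaries; the value ends up
    in [treg d]. A variable out of scope yields 0, the default of [nth] in [eval]. In a [Fold] the
    accumulator lives in a variable register, which frees [treg d] for the loop test. *)
Fixpoint comp (b d : nat) (e : exp) : cmd :=
  match e with
  | Var i => if i < b then move (treg d) (vreg i) (treg d)
             else CConst (treg d) 0
  | Cst x => CConst (treg d) x
  | Bin o e1 e2 =>
      seqs [:: comp b d e1; comp b d.+1 e2;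
               COp o (treg d) (treg d) (treg d.+1)]
  | Ld e1 => CSeq (comp b d e1) (CLoad (treg d) (treg d))
  | Qry e1 => CSeq (comp b d e1) (CQuery (treg d) (treg d))
  | If e0 e1 e2 =>
      CSeq (comp b d e0) (CIf (treg d) (comp b d e1) (comp b d e2))
  | Let e1 f =>
      seqs [:: comp b d e1; move (vreg b) (treg d) (treg d.+1);
               comp b.+1 d (f b)]
  | Fold e1 f =>
      seqs [:: comp b d e1; move (vreg b.+1) (treg d) (treg d.+1);
               CConst (vreg b) 0; COp OpLt (treg d) (vreg b) (vreg 0);
               CWhile (treg d)
                 (seqs [:: comp b.+2 d (f b b.+1);
                           move (vreg b.+1) (treg d) (treg d.+1);
                           CConst (treg d) 1;
                           COp OpAdd (vreg b) (vreg b) (treg d);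
                           COp OpLt (treg d) (vreg b) (vreg 0)]);
               move (treg d) (vreg b.+1) (treg d)]
  end.

(** [vreg 1] counts the cells. The content is evaluated at depth 1 so that the address survives in
    [treg 0]. *)
Definition fill (test addr cell : exp) : cmd :=
  seqs [:: CConst (vreg 1) 0; comp 2 0 test;
           CWhile (treg 0)
             (seqs [:: comp 2 0 addr; comp 2 1 cell; CStore (treg 0) (treg 1);
                       CConst (treg 0) 1; COp OpAdd (vreg 1) (vreg 1) (treg 0);
                       comp 2 0 test])].

(** The input has [n] and [m] in cells 0 and 1; register 0, which is [vreg 0], receives
    [D = n + m + 2]. This exceeds all values of [a], [j] and [r] that the recurrence uses, so it can
    serve both as radix of the cell index and as common loop bound. *)
Definition program (test addr cell final : exp) : cmd :=
  seqs [:: CConst 1 0; CLoad 1 1; CConst 3 1; CLoad 3 3; COp OpAdd 1 1 3;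
           CConst 3 2; COp OpAdd 0 1 3; fill test addr cell;
           comp 2 0 final; CConst 3 0; COp OpLt 0 3 1].

(** Both branches of an [If] are charged, which keeps the bound syntactic. In a [Fold], 7 is the
    overhead of a round with its test, and 8 that of entry, last test and exit. *)
Fixpoint cost (D b : nat) (e : exp) : nat :=
  match e with
  | Var _ => 2
  | Cst _ => 1
  | Bin _ e1 e2 => cost D b e1 + cost D b e2 + 2
  | Ld e1 | Qry e1 => cost D b e1 + 1
  | If e0 e1 e2 => cost D b e0 + cost D b e1 + cost D b e2 + 1
  | Let e1 f => cost D b e1 + cost D b.+1 (f b) + 3
  | Fold e1 f => cost D b e1 + D * (cost D b.+2 (f b b.+1) + 7) + 8
  end.

(** A fixed expression nests its loops to a fixed depth, and each level contributes one factor [D].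
    Exponents are added rather than maximised, so that the single inequality [comb] serves every
    constructor. *)
Lemma cost_poly (e : exp) (b : nat) :
  exists A B, forall D, 0 < D -> cost D b e <= A * D ^ B.
Proof.
have comb A1 B1 A2 B2 D : 0 < D ->
    A1 * D ^ B1 + A2 * D ^ B2 <= (A1 + A2) * D ^ (B1 + B2).
  move=> D0; rewrite mulnDl leq_add // leq_mul2l leq_pexp2l ?orbT //; lia.
elim: e b => [i|x|o e1 IH1 e2 IH2|e1 IH1|e1 IH1|e0 IH0 e1 IH1 e2 IH2|e1 IH1 f IH
   |e1 IH1 f IH] b /=.
- by exists 2, 0 => D _; rewrite expn0.
- by exists 1, 0 => D _; rewrite expn0.
- have [A1 [B1 H1]] := IH1 b; have [A2 [B2 H2]] := IH2 b.
  exists (A1 + A2 + 2), (B1 + B2 + 0) => D D0.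
  apply: leq_trans (comb _ _ _ _ _ D0).
  by rewrite leq_add ?expn0 // (leq_trans _ (comb _ _ _ _ _ D0)) // leq_add ?H1
    ?H2.
- have [A1 [B1 H1]] := IH1 b.
  exists (A1 + 1), (B1 + 0) => D D0; apply: leq_trans (comb _ _ _ _ _ D0).
  by rewrite leq_add ?expn0 // H1.
- have [A1 [B1 H1]] := IH1 b.
  exists (A1 + 1), (B1 + 0) => D D0; apply: leq_trans (comb _ _ _ _ _ D0).
  by rewrite leq_add ?expn0 // H1.
- have [A0 [B0 H0]] := IH0 b; have [A1 [B1 H1]] := IH1 b.
  have [A2 [B2 H2]] := IH2 b.
  exists (A0 + A1 + A2 + 1), (B0 + B1 + B2 + 0) => D D0.
  apply: leq_trans (comb _ _ _ _ _ D0); rewrite leq_add ?expn0 //.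
  apply: leq_trans (comb _ _ _ _ _ D0); rewrite leq_add ?H2 //.
  by apply: leq_trans (comb _ _ _ _ _ D0); rewrite leq_add ?H0 ?H1.
- have [A1 [B1 H1]] := IH1 b; have [A2 [B2 H2]] := IH b b.+1.
  exists (A1 + A2 + 3), (B1 + B2 + 0) => D D0.
  apply: leq_trans (comb _ _ _ _ _ D0); rewrite leq_add ?expn0 //.
  by apply: leq_trans (comb _ _ _ _ _ D0); rewrite leq_add ?H1 ?H2.
have [A1 [B1 H1]] := IH1 b; have [A2 [B2 H2]] := IH b b.+1 b.+2.
exists (A1 + (A2 + 7) + 8), (B1 + (B2 + 0).+1 + 0) => D D0.
apply: leq_trans (comb _ _ _ _ _ D0); rewrite leq_add ?expn0 //.
apply: leq_trans (comb _ _ _ _ _ D0); rewrite leq_add ?H1 //.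
rewrite expnS mulnCA leq_mul2l; apply/orP; right.
by apply: leq_trans (comb _ _ _ _ _ D0); rewrite leq_add ?H2 ?expn0.
Qed.

(** * Timed Hoare rules and correctness of compiled code *)

Section Machine.
Variables (w : nat) (oracle : nat -> nat).

Definition runs (c : cmd) (s : state) (T : nat) (Q : state -> Prop) : Prop :=
  exists t s', [/\ exec w oracle c s t s', t <= T & Q s'].

Lemma runs_le c s T T' (Q Q' : state -> Prop) :
  runs c s T Q -> T <= T' -> (forall s', Q s' -> Q' s') -> runs c s T' Q'.
Proof.
by case=> t [s' [h le q]] leT QQ; exists t, s'; split; [|lia|exact: QQ].
Qed.

Lemma runs_seq c1 c2 s T1 T2 Q :
  runs c1 s T1 (fun s1 => runs c2 s1 T2 Q) -> runs (CSeq c1 c2) s (T1 + T2) Q.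
Proof.
case=> t1 [s1 [h1 le1 [t2 [s2 [h2 le2 q]]]]].
by exists (t1 + t2), s2; split; [exact: ESeq h1 h2 | lia |].
Qed.

Lemma runs_bind c1 c2 s T1 T2 T (Q1 Q : state -> Prop) :
  runs c1 s T1 Q1 -> (forall s1, Q1 s1 -> runs c2 s1 T2 Q) -> T1 + T2 <= T ->
  runs (CSeq c1 c2) s T Q.
Proof.
move=> h1 h2 le; apply: (runs_le _ le (fun _ q => q)).
by apply: runs_seq; apply: (runs_le h1).
Qed.

Lemma runs_op o i j k s (Q : state -> Prop) :
  Q (set_reg s i (eval_op w o (reg s j) (reg s k))) ->
  runs (COp o i j k) s 1 Q.
Proof. by move=> q; eexists; eexists; split; [exact: EOp | |]. Qed.

Lemma runs_const i x s (Q : state -> Prop) :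
  Q (set_reg s i (x %% 2 ^ w)) -> runs (CConst i x) s 1 Q.
Proof. by move=> q; eexists; eexists; split; [exact: EConst | |]. Qed.

Lemma runs_load i j s (Q : state -> Prop) :
  Q (set_reg s i (mem s (reg s j))) -> runs (CLoad i j) s 1 Q.
Proof. by move=> q; eexists; eexists; split; [exact: ELoad | |]. Qed.

Lemma runs_store i j s (Q : state -> Prop) :
  Q (set_mem s (reg s i) (reg s j)) -> runs (CStore i j) s 1 Q.
Proof. by move=> q; eexists; eexists; split; [exact: EStore | |]. Qed.

Lemma runs_query i j s (Q : state -> Prop) :
  Q (set_reg s i (oracle (reg s j))) -> runs (CQuery i j) s 1 Q.
Proof. by move=> q; eexists; eexists; split; [exact: EQuery | |]. Qed.

Lemma runs_skip s (Q : state -> Prop) : Q s -> runs CSkip s 1 Q.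
Proof. by move=> q; eexists; eexists; split; [exact: ESkip | |]. Qed.

Lemma runs_move i j z s (Q : state -> Prop) :
  j != z ->
  Q (set_reg (set_reg s z 0) i (reg s j)) -> runs (move i j z) s 2 Q.
Proof.
move=> jz q; apply: (@runs_seq _ _ _ 1 1); apply: runs_const.
apply: runs_op; rewrite /= mod0n /upd eqxx (negPf jz).
by rewrite modn0.
Qed.

Lemma runs_if i c1 c2 s T1 T2 Q :
  (reg s i != 0 -> runs c1 s T1 Q) -> (reg s i = 0 -> runs c2 s T2 Q) ->
  runs (CIf i c1 c2) s (T1 + T2).+1 Q.
Proof.
move=> h1 h2; case: (altP (reg s i =P 0)) => h.
  have [t [s' [x le q]]] := h2 h.
  by exists t.+1, s'; split; [exact: EIfFalse | lia |].
have [t [s' [x le q]]] := h1 h.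
by exists t.+1, s'; split; [exact: EIfTrue | lia |].
Qed.

(** The invariant carries the number of finished rounds and thereby fixes the outcome of the test:
    there are exactly [N] rounds and [N.+1] tests. *)
Lemma runs_while i c s T N (J : nat -> state -> Prop) :
  J 0 s ->
  (forall x s1, x <= N -> J x s1 -> (reg s1 i != 0) = (x < N)) ->
  (forall x s1, x < N -> J x s1 -> runs c s1 T (J x.+1)) ->
  runs (CWhile i c) s (N * T.+1).+1 (J N).
Proof.
move=> J0 Jt Jc.
suff H k x s1 : x + k = N -> J x s1 ->
    runs (CWhile i c) s1 (k * T.+1).+1 (J N) by apply: (H N 0).
elim: k x s1 => [|k IH] x s1 xk Jx.
  have e : x = N by lia.
  exists 1, s1; split => //; last by rewrite -e.
  by apply: EWhileFalse; apply/eqP; rewrite -[_ == _]negbK (Jt _ _ _ Jx) ; lia.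
have xN : x < N by lia.
have [t1 [s2 [h1 le1 J1]]] := Jc _ _ xN Jx.
have [|t2 [s3 [h2 le2 J2]]] := IH x.+1 s2 _ J1; first by lia.
exists (t1 + t2).+1, s3; split => //; last by lia.
by apply: EWhileTrue h1 h2; rewrite (Jt _ _ _ Jx) //; lia.
Qed.

Definition env_ok (rho : seq nat) (s : state) :=
  forall i, i < size rho -> reg s (vreg i) = nth 0 rho i.

Definition temps_kept (d : nat) (s s' : state) :=
  forall i, i < d -> reg s' (treg i) = reg s (treg i).

Lemma vtE i j : (vreg i == treg j) = false.
Proof. rewrite /vreg /treg; lia. Qed.
Lemma tvE i j : (treg i == vreg j) = false.
Proof. rewrite /vreg /treg; lia. Qed.
Lemma vvE i j : (vreg i == vreg j) = (i == j).
Proof. rewrite /vreg; lia. Qed.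
Lemma ttE i j : (treg i == treg j) = (i == j).
Proof. rewrite /treg; lia. Qed.
Definition regE := (vtE, tvE, vvE, ttE).

Lemma env_ok_rcons rho s x :
  env_ok rho s -> reg s (vreg (size rho)) = x -> env_ok (rcons rho x) s.
Proof.
move=> h hx i; rewrite size_rcons ltnS nth_rcons leq_eqVlt.
by case: ltnP => [lt _|_]; [exact: h | rewrite orbF => /[dup] /eqP-> ->].
Qed.

Lemma env_ok_rconsW rho s x : env_ok (rcons rho x) s -> env_ok rho s.
Proof.
move=> h i lti; have := h i; rewrite size_rcons nth_rcons lti; apply.
exact: ltnW.
Qed.

Lemma env_ok_last rho s x :
  env_ok (rcons rho x) s -> reg s (vreg (size rho)) = x.
Proof. by move=> /(_ (size rho)); rewrite size_rcons nth_rcons ltnn eqxx;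
  apply. Qed.

Variable D : nat.
Hypothesis D_word : D < 2 ^ w.
Hypothesis D_gt0 : 0 < D.

Lemma one_word : 1 %% 2 ^ w = 1.
Proof. by rewrite modn_small //; apply: leq_ltn_trans D_word. Qed.

(** Keeping the temporaries below [d] lets a first operand wait in [treg d] while the second is
    evaluated at depth [d.+1]. Variable 0 must hold [D] because every [Fold] reads its bound there.
    Registers of variables out of scope may be overwritten. *)
Lemma comp_correct (e : exp) (rho : seq nat) (d : nat) (s : state) :
  0 < size rho -> nth 0 rho 0 = D -> env_ok rho s ->
  runs (comp (size rho) d e) s (cost D (size rho) e) (fun s' =>
    [/\ mem s' = mem s, reg s' (treg d) = eval w D oracle (mem s) rho e,
        env_ok rho s' & temps_kept d s s']).
Proof.
elim: e rho d s => [i|x|o e1 IH1 e2 IH2|e1 IH1|e1 IH1|e0 IH0 e1 IH1 e2 IH2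
   |e1 IH1 f IH|e1 IH1 f IH] rho d s rho0 rhoD ok /=.
- case: ltnP => lti.
    apply: runs_move; first by rewrite regE.
    split=> //=; rewrite /upd ?eqxx ?ok //.
      by move=> k ltk; rewrite /= /upd !regE ok.
    by move=> k ltk; rewrite /= /upd !regE ltn_eqF.
  apply: runs_le (leqnSn 1) (fun _ q => q); apply: runs_const.
  split=> //=; rewrite /upd ?eqxx ?mod0n ?nth_default //.
    by move=> k ltk; rewrite /= /upd !regE ok.
  by move=> k ltk; rewrite /= /upd !regE ltn_eqF.
- apply: runs_const; split=> //=; rewrite /upd ?eqxx //.
    by move=> k ltk; rewrite /= /upd !regE ok.
  by move=> k ltk; rewrite /= /upd !regE ltn_eqF.
- apply: runs_bind (IH1 rho d s rho0 rhoD ok) _ _; last first.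
    by rewrite -addnA leq_add2l; exact: leqnn.
  move=> s1 [m1 v1 ok1 k1].
  apply: runs_bind (IH2 rho d.+1 s1 rho0 rhoD ok1) _ (leqnn _).
  move=> s2 [m2 v2 ok2 k2]; apply: (@runs_seq _ _ _ 1 1).
  apply: runs_op; apply: runs_skip; split=> /=.
  + by rewrite m2 m1.
  + by rewrite /upd eqxx v2 k2 // v1 m1.
  + by move=> k ltk; rewrite /= /upd !regE ok2.
  + by move=> k ltk; rewrite /= /upd !regE ltn_eqF // k2 ?k1 // ltnW.
- apply: runs_bind (IH1 rho d s rho0 rhoD ok) _ (leqnn _).
  move=> s1 [m1 v1 ok1 k1]; apply: runs_load; split=> //=.
  + by rewrite /upd eqxx m1 v1.
  + by move=> k ltk; rewrite /= /upd !regE ok1.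
  + by move=> k ltk; rewrite /= /upd !regE ltn_eqF // k1.
- apply: runs_bind (IH1 rho d s rho0 rhoD ok) _ (leqnn _).
  move=> s1 [m1 v1 ok1 k1]; apply: runs_query; split=> //=.
  + by rewrite /upd eqxx v1.
  + by move=> k ltk; rewrite /= /upd !regE ok1.
  + by move=> k ltk; rewrite /= /upd !regE ltn_eqF // k1.
- apply: runs_bind (IH0 rho d s rho0 rhoD ok) _ _; last first.
    by rewrite -!addnA leq_add2l addnA addn1; exact: leqnn.
  move=> s1 [m1 v1 ok1 k1]; apply: runs_if; rewrite v1 => c.
    apply: runs_le (IH1 rho d s1 rho0 rhoD ok1) (leqnn _) _.
    move=> s2 [m2 v2 ok2 k2]; rewrite c m2 v2 m1; split=> // k ltk.
    by rewrite k2 ?k1.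
  apply: runs_le (IH2 rho d s1 rho0 rhoD ok1) (leqnn _) _.
  move=> s2 [m2 v2 ok2 k2]; rewrite c m2 v2 m1; split=> // k ltk.
  by rewrite k2 ?k1.
- apply: runs_bind (IH1 rho d s rho0 rhoD ok) _ _; last first.
    by rewrite -!addnA leq_add2l; exact: leqnn.
  move=> s1 [m1 v1 ok1 k1].
  apply: (@runs_bind _ _ _ 2 (cost D (size rho).+1 (f (size rho)) + 1));
    last by lia.
    by apply: runs_move; [rewrite regE ltn_eqF | exact: erefl].
  move=> _ <-; set s2 := set_reg _ _ _.
  have ok2 : env_ok (rcons rho (eval w D oracle (mem s) rho e1)) s2.
    apply: env_ok_rcons => [i lti|]; rewrite /s2 /= /upd !regE ?eqxx //.
    by rewrite ltn_eqF // ok1.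
  have := IH (size rho) _ d s2 _ _ ok2; rewrite size_rcons => IH'.
  apply: runs_bind (IH' _ _) _ (leqnn _) => //; first by rewrite nth_rcons rho0.
  move=> s3 [m3 v3 ok3 k3]; apply: runs_skip; split=> //=.
  + by rewrite m3 /= m1.
  + by rewrite v3 /= m1.
  + exact: env_ok_rconsW ok3.
  + move=> k ltk; rewrite k3 //= /s2 /= /upd !regE (ltn_eqF (ltnW _)) //.
    by rewrite k1.
set F := fun x acc => eval w D oracle (mem s) (rcons (rcons rho x) acc) _.
set bd := f (size rho) (size rho).+1; set C := cost D (size rho).+2 bd.
apply: runs_bind (IH1 rho d s rho0 rhoD ok) _ _; last first.
  by rewrite -!addnA leq_add2l; exact: leqnn.
move=> s1 [m1 v1 ok1 k1].
apply: (@runs_bind _ _ _ 2 (D * (C + 7) + 6)); last by lia.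
  by apply: runs_move; [rewrite regE ltn_eqF | exact: erefl].
move=> _ <-; apply: (@runs_bind _ _ _ 1 (D * (C + 7) + 5)); last by lia.
  by apply: runs_const; exact: erefl.
move=> _ <-; apply: (@runs_bind _ _ _ 1 (D * (C + 7) + 4)); last by lia.
  by apply: runs_op; exact: erefl.
move=> _ <-; set s2 := set_reg _ _ _.
pose J x s' := [/\ mem s' = mem s, reg s' (treg d) = (x < D),
  env_ok (rcons (rcons rho x) (iteri x F (eval w D oracle (mem s) rho e1))) s'
  & temps_kept d s s'].
have vD s' acc x : env_ok (rcons (rcons rho x) acc) s' -> reg s' (vreg 0) = D.
  move=> /env_ok_rconsW /env_ok_rconsW h.
  by rewrite h.
have J0 : J 0 s2.
  rewrite /J /s2; split=> //.
  - by rewrite /= /upd !regE !eqxx mod0n (ltn_eqF rho0) (ltn_eqF (ltnW _)) //=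
    ok1 ?rhoD.
  - apply: env_ok_rcons.
      apply: env_ok_rcons => [i lti|]; rewrite /= /upd !regE ?eqxx ?mod0n //.
      by rewrite ltn_eqF // ltn_eqF ?ok1 // ltnW.
    by rewrite /= /upd !regE size_rcons eqxx gtn_eqF.
  - move=> k ltk; rewrite /= /upd !regE ltn_eqF // (ltn_eqF (ltnW _)) //.
    by rewrite k1.
apply: (@runs_bind _ _ _ (D * (C + 6).+1).+1 3); last by lia.
  apply: (runs_while J0) => [x s3 _ [_ -> _ _]|x s3 ltx [m3 v3 ok3 k3]].
    by rewrite eqb0 negbK.
  have := IH (size rho) (size rho).+1 _ d s3 _ _ ok3;
    rewrite !size_rcons => IH'.
  apply: runs_bind (IH' _ _) _ (leqnn _) => //.
    by rewrite !nth_rcons size_rcons rho0 ltnW.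
  move=> s4 [m4 v4 ok4 k4]; apply: (@runs_bind _ _ _ 2 4) => //.
    by apply: runs_move; [rewrite regE ltn_eqF | exact: erefl].
  move=> _ <-; apply: (@runs_bind _ _ _ 1 3) => //.
    by apply: runs_const; exact: erefl.
  move=> _ <-; apply: (@runs_bind _ _ _ 1 2) => //.
    by apply: runs_op; exact: erefl.
  move=> _ <-; apply: (@runs_bind _ _ _ 1 1) => //.
    by apply: runs_op; exact: erefl.
  move=> _ <-; apply: runs_skip.
  have x4 : reg s4 (vreg (size rho)) = x.
    by apply: env_ok_last (env_ok_rconsW ok4).
  have v0 := vD _ _ _ ok4.
  (* The counter never exceeds [D], which is a word, so its increment does not wrap. *)
  have xw : (x + 1) %% 2 ^ w = x.+1 by rewrite addn1 modn_small //; lia.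
  have s0 : (0 == size rho) = false by rewrite ltn_eqF.
  split.
  - by rewrite /= m4.
  - by rewrite /= /upd !regE !eqxx one_word (ltn_eqF (leqnn _)) x4 xw s0 /= v0.
  - apply: env_ok_rcons.
      apply: env_ok_rcons => [i lti|]; rewrite /= /upd !regE ?eqxx.
        rewrite (ltn_eqF lti) (ltn_eqF (ltnW _)) //.
        by have /env_ok_rconsW/env_ok_rconsW -> := ok4.
      by rewrite /= ?eqxx one_word (ltn_eqF (leqnn _)) x4 xw.
    by rewrite /= /upd !regE size_rcons (gtn_eqF (leqnn _)) eqxx v4 m3.
  - move=> k ltk; rewrite /= /upd !regE ltn_eqF // (ltn_eqF (ltnW _)) //.
    by rewrite k4 ?k3.
move=> s3 [m3 v3 ok3 k3]; apply: (@runs_bind _ _ _ 2 1) => //.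
  by apply: runs_move; [rewrite regE | exact: erefl].
move=> _ <-; apply: runs_skip; split=> //=.
- rewrite /upd eqxx; have := env_ok_last ok3.
  by rewrite size_rcons.
- move=> k ltk; rewrite /= /upd !regE.
  by have /env_ok_rconsW/env_ok_rconsW -> := ok3.
- by move=> k ltk; rewrite /= /upd !regE ltn_eqF // k3.
Qed.
(** The address is itself evaluated in the memory built so far; that the writes do not collide is
    settled separately, in [mem_ok_fill]. *)
Fixpoint fillmem (addr cell : exp) (mu : nat -> nat) (t : nat) : nat -> nat :=
  if t is t'.+1 then
    let mu' := fillmem addr cell mu t' in
    upd mu' (eval w D oracle mu' [:: D; t'] addr)
            (eval w D oracle mu' [:: D; t'] cell)
  else mu.

Lemma fill_correct (test addr cell : exp) (N : nat) (s : state) :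
  reg s (vreg 0) = D -> N < 2 ^ w ->
  (forall t, t <= N ->
     eval w D oracle (fillmem addr cell (mem s) t) [:: D; t] test = (t < N)) ->
  runs (fill test addr cell) s
    (N * (cost D 2 addr + cost D 2 cell + cost D 2 test + 5)
     + cost D 2 test + 3)
    (fun s' => [/\ mem s' = fillmem addr cell (mem s) N,
                   reg s' (vreg 0) = D & reg s' (vreg 1) = N]).
Proof.
move=> sD Nw tst; set M := fillmem addr cell (mem s) in tst *.
set ca := cost D 2 addr; set cc := cost D 2 cell; set ct := cost D 2 test.
pose E x s' := [/\ mem s' = M x, reg s' (vreg 0) = D & reg s' (vreg 1) = x].
have Eok x s' : E x s' -> env_ok [:: D; x] s' by case=> _ h0 h1 [|[]].
pose J x s' := E x s' /\ reg s' (treg 0) = (x < N).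
have testP x s' : x <= N -> E x s' ->
    runs (comp 2 0 test) s' ct (J x).
  move=> lex /[dup] [[m1 v0 v1]] /Eok ok.
  apply: runs_le (comp_correct test 0 _ _ ok) (leqnn _) _ => //.
  move=> s2 [m2 t2 ok2 _]; rewrite /J /E m2 t2 m1 tst //.
  by split=> //; split=> //; [exact: (ok2 0) | exact: (ok2 1)].
apply: (@runs_bind _ _ _ 1 (ct + (N * (ca + cc + ct + 4).+1 + 2))); last by lia.
  by apply: runs_const; exact: erefl.
move=> _ <-; set s1 := set_reg _ _ _.
have E1 : E 0 s1.
  rewrite /E /s1; split=> //.
  by rewrite /= /upd !regE mod0n.
apply: runs_bind (testP _ _ (leq0n _) E1) _ (leqnn _) => s2 J2.
apply: (@runs_bind _ _ _ (N * (ca + cc + ct + 4).+1).+1 1); last by lia.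
  apply: (runs_while J2) => [x s3 _ [_ ->]|x s3 ltx [E3 _]].
    by rewrite eqb0 negbK.
  have ok3 := Eok _ _ E3; case: E3 => m3 D3 t3.
  have := comp_correct addr 0 (isT : 0 < size [:: D; x]) erefl ok3.
  move/runs_bind; apply; last by rewrite -?addnA leq_add2l; exact: leqnn.
  move=> s4 [m4 v4 ok4 k4].
  have := comp_correct cell 1 (isT : 0 < size [:: D; x]) erefl ok4.
  move/runs_bind; apply; last by rewrite -?addnA leq_add2l; exact: leqnn.
  move=> s5 [m5 v5 ok5 k5].
  apply: (@runs_bind _ _ _ 1 (ct + 3)); last by rewrite /ct; lia.
    by apply: runs_store; exact: erefl.
  move=> _ <-; apply: (@runs_bind _ _ _ 1 (ct + 2)); last by lia.
    by apply: runs_const; exact: erefl.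
  move=> _ <-; apply: (@runs_bind _ _ _ 1 (ct + 1)); last by lia.
    by apply: runs_op; exact: erefl.
  move=> _ <-; set s6 := set_reg _ _ _.
  have E6 : E x.+1 s6.
    rewrite /E /s6; split=> //.
    - by rewrite /= m5 m4 m3 v5 k5 // v4 m4 m3.
    - by rewrite /= /upd !regE (ok5 0).
    - rewrite /= /upd !regE /= one_word (ok5 1) //= addn1 modn_small //; lia.
  apply: runs_bind (testP _ _ ltx E6) _ (leqnn _) => s7 J7.
  exact: runs_skip.
by move=> s3 [E3 _]; apply: runs_skip.
Qed.

Lemma program_correct (test addr cell final : exp) (N : nat) (s : state) :
  mem s 0 + mem s 1 + 2 = D -> N < 2 ^ w ->
  (forall t, t <= N ->
     eval w D oracle (fillmem addr cell (mem s) t) [:: D; t] test = (t < N)) ->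
  runs (program test addr cell final) s
    (N * (cost D 2 addr + cost D 2 cell + cost D 2 test + 5)
     + cost D 2 test + cost D 2 final + 13)
    (fun s' => reg s' 0 =
       (0 < eval w D oracle (fillmem addr cell (mem s) N) [:: D; N] final)).
Proof.
move=> sD Nw tst; rewrite /program.
set cf := cost D 2 final; set CF := _ + cost D 2 test.
apply: (@runs_bind _ _ _ 1 (CF + cf + 12)); last by lia.
  by apply: runs_const; exact: erefl.
move=> _ <-; apply: (@runs_bind _ _ _ 1 (CF + cf + 11)); last by lia.
  by apply: runs_load; exact: erefl.
move=> _ <-; apply: (@runs_bind _ _ _ 1 (CF + cf + 10)); last by lia.
  by apply: runs_const; exact: erefl.
move=> _ <-; apply: (@runs_bind _ _ _ 1 (CF + cf + 9)); last by lia.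
  by apply: runs_load; exact: erefl.
move=> _ <-; apply: (@runs_bind _ _ _ 1 (CF + cf + 8)); last by lia.
  by apply: runs_op; exact: erefl.
move=> _ <-; apply: (@runs_bind _ _ _ 1 (CF + cf + 7)); last by lia.
  by apply: runs_const; exact: erefl.
move=> _ <-; apply: (@runs_bind _ _ _ 1 (CF + cf + 6)); last by lia.
  by apply: runs_op; exact: erefl.
move=> _ <-; set s1 := set_reg _ _ _.
have D1 : reg s1 (vreg 0) = D.
  by rewrite /s1 /= /upd /= mod0n one_word modnDml modnDmr sD modn_small.
apply: (@runs_bind _ _ _ (CF + 3) (cf + 3)); last by lia.
  exact: (fill_correct D1 Nw tst).
move=> s2 [m2 D2 N2].
have ok2 : env_ok [:: D; N] s2 by case=> [|[]].
have := comp_correct final 0 (isT : 0 < size [:: D; N]) erefl ok2.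
move/runs_bind; apply; last exact: leqnn.
move=> s3 [m3 v3 _ _]; apply: (@runs_bind _ _ _ 1 2) => //.
  by apply: runs_const; exact: erefl.
move=> _ <-; apply: (@runs_bind _ _ _ 1 1) => //.
  by apply: runs_op; exact: erefl.
move=> _ <-; apply: runs_skip.
by rewrite /= /upd /= mod0n v3 m2.
Qed.

End Machine.

(** * Subset transforms *)

Section SubsetTransforms.
Variables (n : nat) (T : finType) (Q : pred T) (f : T -> {set 'I_n}).
Implicit Types (S A : {set 'I_n}) (D : pred 'I_n).

(* For [D] ranging over initial or final segments these are the partial
   sums of the zeta and Moebius transforms over the subsets of [S]. *)
Definition between D S (A : {set 'I_n}) : bool :=
  [forall u, if D u then (u \in A) == (u \in S) else (u \in A) ==> (u \in S)].

Definition num_between D S : nat := #|[set x | Q x & between D S (f x)]|.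

Lemma eq_num_between D1 D2 S : D1 =1 D2 -> num_between D1 S = num_between D2 S.
Proof.
move=> eqD; apply: eq_card => x; rewrite !inE; congr (_ && _).
by apply: eq_forallb => u; rewrite eqD.
Qed.

Lemma num_between0 S : num_between pred0 S = #|[set x | Q x & f x \subset S]|.
Proof.
apply: eq_card => x; rewrite !inE; congr (_ && _); apply/forallP/subsetP => h u.
  exact: implyP (h u).
by apply/implyP; exact: h.
Qed.

Lemma num_betweenT S : num_between predT S = #|[set x | Q x & f x == S]|.
Proof.
apply: eq_card => x; rewrite !inE; congr (_ && _).
by apply/forallP/eqP => [h|-> u]; [apply/setP=> u; apply/eqP | rewrite /=].
Qed.

Lemma between_in D S A v : ~~ D v -> v \in A ->
  between D S A = (v \in S) && between (predU1 v D) S A.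
Proof.
move=> Dv vA; apply/forallP/andP => [h|[vS /forallP h] u].
  have vS : v \in S by have := h v; rewrite (negPf Dv) vA.
  split=> //; apply/forallP => u /=; case: (u =P v) => [->|_] /=; last exact: h.
  by rewrite vA vS.
by have /= := h u; case: (u =P v) => [->|_] //=; rewrite (negPf Dv) vS implybT.
Qed.

Lemma between_notin D S A v : ~~ D v -> v \notin A ->
  between D S A = between (predU1 v D) (S :\ v) A.
Proof.
move=> Dv vA; apply: eq_forallb => u /=; rewrite !inE.
by case: (u =P v) => [->|_] //=; rewrite (negPf Dv) (negPf vA).
Qed.

(** One coordinate step of both transforms. Sets that contain [v] can only agree at [v] with [S],
    those that avoid it with [S :\ v]; if [v] is not in [S], only the latter occur and [S :\ v] is
    [S]. Read as it stands this is a zeta step; solved for the first summand it is a Moebius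
    step. *)
Lemma num_between_split D v S : ~~ D v ->
  num_between D S = num_between (predU1 v D) S +
              (if v \in S then num_between (predU1 v D) (S :\ v) else 0).
Proof.
move=> Dv; rewrite /num_between; set X := [set x | _].
rewrite -(cardsID [set x | v \in f x] X).
have in_bet A S' : between (predU1 v D) S' A -> (v \in A) = (v \in S').
  by move=> /forallP /(_ v) /=; rewrite eqxx => /eqP.
case: ifPn => vS.
  congr (_ + _); apply: eq_card => x; rewrite !inE.
    case vx : (v \in f x); rewrite ?andbT ?andbF.
      by rewrite (between_in _ Dv vx) vS.
    by apply/esym/negP => /andP[_ /in_bet]; rewrite vx vS.
  case vx : (v \in f x) => /=.
    by apply/esym/negP => /andP[_ /in_bet]; rewrite vx !inE eqxx.
  by rewrite (between_notin _ Dv) ?vx.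
rewrite addnC; congr (_ + _).
  apply: eq_card => x; rewrite !inE.
  case vx : (v \in f x) => /=.
    by apply/esym/negP => /andP[_ /in_bet]; rewrite vx (negPf vS).
  by rewrite (between_notin _ Dv) ?vx // (setDidPl _) // disjoint_sym
    disjoints1.
apply: eq_card0 => x; rewrite !inE; apply/negP => /andP[/andP[_ h] vx].
by move: h; rewrite (between_in _ Dv vx) (negPf vS).
Qed.

End SubsetTransforms.

(** * Districts and slots *)

Section Districts.
Variables (n m : nat) (I : wgm n m).

Lemma induced_sym U : connect_sym (induced I U).
Proof.
apply: sym_connect_sym => x y; rewrite /induced /= adj_sym.
by case: (x \in U); case: (y \in U).
Qed.

Lemma district1 v : district I [set v].
Proof.
rewrite /district -card_gt0 cards1 /=; apply/forall_inP => x /set1P->.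
by apply/forall_inP => y /set1P->.
Qed.

Lemma districtU1 W u v :
  district I W -> u \in W -> adj I u v -> district I (v |: W).
Proof.
move=> /andP[W0 /forall_inP cW] uW uv; apply/andP; split.
  by apply/set0Pn; exists v; rewrite setU11.
have con x : x \in v |: W -> connect (induced I (v |: W)) u x.
  case/setU1P => [->|xW].
    by apply: connect1; rewrite /induced /= setU11 setU1r ?uv.
  have /forall_inP/(_ _ xW) := cW _ uW.
  apply: connect_sub => a b /= /and3P[aW bW ab]; apply: connect1.
  by rewrite /induced /= !setU1r.
apply/forall_inP => x /con ux; apply/forall_inP => y /con.
by apply: connect_trans; rewrite induced_sym.
Qed.

(* A connected proper subset of [U] of maximal size misses just one vertex:
   otherwise it could be extended along an edge leaving it. *)
Lemma district_rec U :
  district I U = (#|U| == 1) ||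
    [exists v in U, district I (U :\ v) && [exists u in U, adj I u v]].
Proof.
apply/idP/orP => [dU|[/cards1P[v ->]|]]; last 2 first.
- exact: district1.
- case/exists_inP => v vU /andP[dv /exists_inP[u uU uv]].
  rewrite -(setD1K vU); apply: (districtU1 dv _ uv).
  by rewrite !inE uU andbT; apply: contraTneq uv => ->; rewrite adj_irr.
have [/set0Pn[x xU] /forall_inP cU] := andP dU.
have [|U1] := eqVneq #|U| 1; [by left | right].
pose ok (W : {set 'I_n}) := district I W && (W \proper U).
have ok1 : ok [set x].
  rewrite /ok district1 properEcard sub1set xU cards1 /=.
  by rewrite ltn_neqAle eq_sym U1; apply/card_gt0P; exists x.
case: (arg_maxnP (fun W : {set 'I_n} => #|W|) ok1) => W /andP[dW pW] maxW.
have [/set0Pn[y yW] _] := andP dW.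
have [/subsetP sW [z zU zW]] := properP pW.
have : [exists u in W, exists v in U :\: W, adj I u v].
  apply: contraT => /exists_inPn no.
  have clW : closed (induced I U) [in W].
    move=> a b /and3P[aU bU ab] /=; apply/idP/idP => [aW|bW];
      apply: contraT => nW.
      have /negP[] := no _ aW; apply/exists_inP; exists b => //.
      by rewrite inE nW.
    have /negP[] := no _ bW; apply/exists_inP; exists a; rewrite 1?adj_sym //.
    by rewrite inE nW.
  have /forall_inP/(_ _ zU) := cU _ (sW _ yW).
  by move/(closed_connect clW); rewrite /= yW (negPf zW).
case/exists_inP=> u uW /exists_inP[v /setDP[vU vW] uv].
have eqU : v |: W = U.
  apply/eqP; apply: contraT => neq.
  have /maxW : ok (v |: W).
    rewrite /ok (districtU1 dW uW uv) /= properEneq neq /=.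
    by apply/subsetP => a /setU1P[->|/sW].
  by rewrite /= cardsU1 vW ltnn.
apply/exists_inP; exists v => //; rewrite -eqU setU1K // dW /=.
by apply/exists_inP; exists u; rewrite ?setU1r.
Qed.
End Districts.


Section Slots.
Variables (n m : nat) (I : wgm n m) (eta : {set 'I_n} -> 'I_m).
Let p := favourite I.

(* Slot [s] belongs to candidate [s %/ n]; [cap s a q] is the number of
   fillable slots of [q] below [s]. *)
Definition cap (s a : nat) (q : 'I_m) : nat :=
  minn (minn (s - q * n) n) (a - (q != p)).

Definition solution (s a j : nat) (P : {set {set 'I_n}}) (S : {set 'I_n}) :=
  [&& partition P S, #|P| == j, [forall U in P, district I U],
      wins eta P p == cap s a p
    & [forall q, (q != p) ==> (wins eta P q <= cap s a q)]].

Definition solvable (s a j : nat) (S : {set 'I_n}) : bool :=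
  [exists P, solution s a j P S].

(* The first open slots of the favourite are those that must be filled. *)
Definition slot_open (s a : nat) : bool := s %% n + (s %/ n != p) < a.
Definition slot_forced (s a : nat) : bool := (s %/ n == p) && (s %% n < a).

(** Only the owner of slot [s] can gain: the minimum with [n] freezes the candidates whose slots all
    lie below [s], and truncated subtraction keeps the later ones at 0. *)
Lemma cap_slot s a (q : 'I_m) : 0 < n ->
  cap s.+1 a q = cap s a q + (slot_open s a && (s %/ n == q)).
Proof.
move=> n0; rewrite /cap /slot_open.
have := divn_eq s n; have := ltn_pmod s n0.
set i := s %% n; set q0 := s %/ n => lti es.
case: (ltngtP q0 q) => [lt|gt|eqq]; rewrite ?andbF ?andbT ?addn0.
- suff -> : s - q * n = 0 by have -> : s.+1 - q * n = 0 by nia.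
  by nia.
- have h : q * n + n <= s by nia.
  by congr minn; lia.
rewrite -eqq -val_eqE /= es -eqq -addnS !addKn; case: eqP => _; lia.
Qed.

Lemma winsD1 (P : {set {set 'I_n}}) U q : U \in P ->
  wins eta P q = (eta U == q) + wins eta (P :\ U) q.
Proof.
move=> UP; rewrite /wins (cardsD1 U) !inE UP /=; congr (_ + _).
by apply: eq_card => V; rewrite !inE andbA.
Qed.

Lemma solvable0 a j S : solvable 0 a j S = (j == 0) && (S == set0).
Proof.
have cap0 q : cap 0 a q = 0 by rewrite /cap sub0n min0n min0n.
apply/existsP/andP => [[P]|[/eqP-> /eqP->]]; last first.
  have w0 q : wins eta set0 q = 0 by apply: eq_card0 => U; rewrite !inE.
  exists set0; apply/and5P; split; rewrite ?partition_set0 ?cards0 ?w0 ?cap0 //.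
    by apply/forall_inP => U; rewrite inE.
  by apply/forallP => q; rewrite w0 implybT.
case/and5P=> pP /eqP<- _ /eqP wp /forallP wq.
suff P0 : P = set0.
  by move: pP; rewrite P0 cards0 /partition /cover big_set0 eq_sym => /andP[].
apply/setP => U; rewrite inE; apply/negP => UP.
suff : wins eta P (eta U) = 0 by rewrite (winsD1 _ UP) eqxx.
have [->|ne] := eqVneq (eta U) p; first by rewrite wp cap0.
by apply/eqP; have := wq (eta U); rewrite ne cap0 leqn0.
Qed.

(** As the slots of a candidate are interchangeable, slot [s] may be considered filled exactly when
    its owner wins more than [cap s] districts, and any one of these can be taken as its content.
    Otherwise the partition already obeys the capacities at [s], which a forced slot excludes
    because the favourite would fall short. *)
Lemma solvable_slot s a j S : 0 < n -> s %/ n < m ->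
  solvable s.+1 a j S =
    [&& slot_open s a, 0 < j &
        [exists U : {set 'I_n}, [&& U \subset S, district I U,
           eta U == s %/ n :> nat & solvable s a j.-1 (S :\: U)]]]
    || (~~ slot_forced s a && solvable s a j S).
Proof.
move=> n0 ltq; pose q0 := Ordinal ltq.
have capE q : cap s.+1 a q = cap s a q + (slot_open s a && (q == q0)).
  by rewrite cap_slot // eq_sym.
have forced_open : slot_forced s a = slot_open s a && (q0 == p).
  rewrite /slot_forced /slot_open -val_eqE /= andbC.
  by case: eqP => _; rewrite ?andbF ?addn0.
apply/existsP/orP => [[P /and5P[pP /eqP cP dP /eqP wp /forallP wq]]|[]].
- have [/andP[op]|nopick] := boolP (slot_open s a && (cap s a q0 < wins eta P
  q0)).
    move=> /(leq_ltn_trans (leq0n _)) /card_gt0P[U];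
      rewrite inE => /andP[UP eU].
    left; rewrite op /=; apply/andP; split; first by rewrite -cP;
      apply/card_gt0P; exists U.
    apply/existsP; exists U; apply/and4P; split.
    + by rewrite -(cover_partition pP); apply: bigcup_sup UP.
    + exact: (forall_inP dP).
    + by rewrite (eqP eU).
    apply/existsP; exists (P :\ U); apply/and5P; split.
    + exact: partitionD1.
    + by rewrite -cP (cardsD1 U P) UP.
    + by apply/forall_inP => V /setD1P[_]; apply: (forall_inP dP).
    + by move: wp; rewrite (winsD1 _ UP) capE op (eqP eU) (eq_sym q0) addnC =>
      /addIn->.
    + apply/forallP => q; have := wq q; case: (q != p) => //=.
      by rewrite (winsD1 _ UP) capE op (eqP eU) (eq_sym q0) addnC leq_add2r.
  (* An open slot of the favourite cannot stay empty: by [wp] its wins equal the new capacity, which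
     exceeds the old one. *)
  have closed : slot_open s a && (p == q0) = false.
    apply/negP => /andP[op /eqP pq]; move: nopick.
    by rewrite op -pq wp capE op pq eqxx addn1 ltnS leqnn.
  right; rewrite forced_open (eq_sym q0) closed /=; apply/existsP; exists P.
  apply/and5P; split; rewrite ?cP ?wp ?capE ?closed ?addn0 //.
  apply/forallP => q; have := wq q; case: (q != p) => //=; rewrite capE.
  have [op|] := boolP (slot_open s a); last by rewrite addn0.
  case: eqP => [->|_]; last by rewrite addn0.
  by move: nopick; rewrite op -leqNgt.
- case/and3P=> op j0 /existsP[U /and4P[US dU eU /existsP[P]]].
  case/and5P=> pP /eqP cP dP /eqP wp /forallP wq.
  have U0 : U != set0 by case/andP: dU.
  (* The blocks of [P] lie in [S :\: U], so the nonempty [U] is a new block and the counts do grow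
     by one. *)
  have nUP : U \notin P.
    apply/negP => UP; have [x xU] := set0Pn _ U0.
    have : x \in cover P by apply/bigcupP; exists U.
    by rewrite (cover_partition pP) inE xU.
  have UP : U \in U |: P by rewrite setU11.
  have eq0 : eta U = q0 by apply/val_inj/eqP.
  exists (U |: P); apply/and5P; split.
  + have dj : [disjoint U & S :\: U].
      by rewrite -setI_eq0; apply/eqP/setP => x; rewrite !inE; case: (x \in U).
    have := partitionU1 pP U0 dj; congr (partition _ _).
    by rewrite -[RHS](setID S U) (setIidPr US).
  + by rewrite cardsU1 nUP cP add1n prednK.
  + by apply/forall_inP => V /setU1P[->|/(forall_inP dP)].
  + by rewrite (winsD1 _ UP) setU1K // capE op eq0 (eq_sym q0) addnC wp.
  + apply/forallP => q; have := wq q; case: (q != p) => //=.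
    by rewrite (winsD1 _ UP) setU1K // capE op eq0 (eq_sym q0) addnC leq_add2r.
case/andP; rewrite forced_open => nf /existsP[P].
case/and5P=> pP cP dP /eqP wp /forallP wq; exists P; apply/and5P; split=> //.
  by rewrite capE (eq_sym p q0) (negPf nf) addn0 wp.
apply/forallP => q; have := wq q; case: (q != p) => //= /leq_trans-> //.
by rewrite capE leq_addr.
Qed.

End Slots.

(** * Disjoint splittings as covering pairs of the right total size *)

Section Pairs.
Variables (n : nat) (Q1 Q2 : pred {set 'I_n}).
Implicit Types (S : {set 'I_n}) (x : {set 'I_n} * {set 'I_n}).

Definition ranked (Q : pred {set 'I_n}) (r : nat) : pred {set 'I_n} :=
  fun A => (#|A| == r) && Q A.

Definition ranked_pair (r : nat) : pred ({set 'I_n} * {set 'I_n}) :=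
  fun x => [&& #|x.1| + #|x.2| == r, Q1 x.1 & Q2 x.2].

Definition pair_cover x := x.1 :|: x.2.

(** A union lies in [S] exactly when both parts do, so the zeta transform turns pairs into products;
    the size of the first part fixes that of the second, whence the sum over ranks. *)
Lemma num_between_pairs r S :
  num_between (ranked_pair r) pair_cover pred0 S =
  \sum_(i < r.+1) num_between (ranked Q1 i) id pred0 S *
                  num_between (ranked Q2 (r - i)) id pred0 S.
Proof.
rewrite num_between0 -sum1_card.
(* [inord] would send a size above [r] to 0, but the rank condition rules such pairs out. *)
rewrite (partition_big (fun x => inord #|x.1| : 'I_r.+1) predT) //=.
apply: eq_bigr => i _; rewrite !num_between0 -cardsX -sum1_card.
apply: eq_bigl => x; rewrite !inE /ranked_pair /ranked /pair_cover subUset.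
have [ri|/negPf ne] := eqVneq #|x.1| i; last first.
  rewrite /= ; apply/negP => /andP[/andP[/and3P[/eqP e _ _] _] /eqP/(congr1
    val)].
  by rewrite /= inordK; [move/eqP; rewrite ne | lia].
have -> : inord #|x.1| == i by rewrite -val_eqE /= inordK ri.
have -> : (#|x.1| + #|x.2| == r) = (#|x.2| == r - i) by have := ltn_ord i; lia.
case: (_ == r - i); rewrite ?andbF //=.
by case: (Q1 _); case: (Q2 _); rewrite ?andbF //= andbT.
Qed.

(** Sizes that add up to the size of the union leave no room for an intersection. *)
Lemma exact_pair S x : ranked_pair #|S| x -> pair_cover x == S ->
  x.1 = S :\: x.2.
Proof.
move=> /and3P[/eqP e _ _] /eqP eS.
have : #|x.1 :&: x.2| = 0 by have := cardsU x.1 x.2;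
  rewrite -/(pair_cover x) eS; have := subset_leq_card (subsetIl x.1 x.2); lia.
move/eqP; rewrite cards_eq0 => /eqP I0.
by rewrite -eS /pair_cover setDUl setDv setU0; apply/esym/setDidPl;
  rewrite -setI_eq0 I0.
Qed.

(** By [exact_pair] the second part determines the pair. This bound is what allows the count to be
    recovered from its residue. *)
Lemma exact_pairs_le S : num_between (ranked_pair #|S|) pair_cover predT S <= 2
  ^ n.
Proof.
rewrite num_betweenT -[X in 2 ^ X]card_ord -cardsT -card_powerset powersetT
  cardsT.
rewrite -(@card_in_imset _ _ snd) ?max_card // => x y.
rewrite !inE => /andP[rx ex] /andP[ry ey] e2.
by rewrite [x]surjective_pairing [y]surjective_pairing (exact_pair rx ex)
  (exact_pair ry ey) e2.
Qed.

Lemma exact_pairs_gt0 S : (0 < num_between (ranked_pair #|S|) pair_cover predT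
  S) =
  [exists U : {set 'I_n}, [&& U \subset S, Q2 U & Q1 (S :\: U)]].
Proof.
rewrite num_betweenT; apply/card_gt0P/existsP => [[x]|[U /and3P[US q2 q1]]].
  rewrite inE => /andP[rx ex]; exists x.2.
  by rewrite -(exact_pair rx ex); case/and3P: rx => _ -> ->;
    rewrite -(eqP ex) subsetUr.
exists (S :\: U, U); rewrite inE /ranked_pair /pair_cover /= q1 q2 !andbT.
rewrite cardsD (setIidPr US) subnK ?subset_leq_card ?eqxx //=.
by rewrite setUC -[X in _ == X](setID S U) (setIidPr US).
Qed.
End Pairs.

(** * Reduction of the decision problem to the last slot *)

Section Answer.
Variables (n m : nat) (I : wgm n m) (eta : {set 'I_n} -> 'I_m).
Let p := favourite I.

Lemma cap_last a q : cap I (m * n) a q = minn n (a - (q != p)).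
Proof.
rewrite /cap; congr minn.
have := ltn_ord q; rewrite -mulnBl => qm; nia.
Qed.

(** [x.+1] is the number of wins of the favourite. It is positive, since some candidate wins a
    district and the favourite beats all others, and at most [n], since districts are nonempty and
    disjoint. The test [ndist I <= n] keeps the number of districts among the levels of [j] that
    store solvability. *)
Lemma wgm_yes_solvable :
  wgm_yes I eta = [exists x : 'I_n, (ndist I <= n) &&
     solvable I eta (m * n) x.+1 (ndist I) [set: 'I_n]].
Proof.
apply/existsP/existsP => [[P /and4P[pP cP dP /forallP wq]]|].
  have Pn : #|P| <= n.
    rewrite -[X in _ <= X]card_ord -cardsT (card_partition pP) -sum1_card.
    apply: leq_sum => U UP; rewrite card_gt0; exact: (partition_neq0 pP UP).
  have wP q : wins eta P q <= #|P|.
    by apply: subset_leq_card; apply/subsetP => U; rewrite inE => /andP[].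
  have w0 : 0 < wins eta P p.
    have : 0 < #|P| by rewrite (eqP cP) ndist_gt0.
    case/card_gt0P => U UP; have [e|ne] := eqVneq (eta U) p.
      by apply/card_gt0P; exists U; rewrite inE UP e eqxx.
    by have := wq (eta U); rewrite ne /=; apply: leq_ltn_trans.
  have wn : (wins eta P p).-1 < n by have := wP p; lia.
  exists (Ordinal wn); rewrite -(eqP cP) Pn /=; apply/existsP; exists P.
  rewrite prednK //; apply/and5P; split=> //.
    by rewrite cap_last -/p eqxx subn0; have := wP p; lia.
  apply/forallP => q; rewrite cap_last -/p; apply/implyP => ne.
  by rewrite ne; have := wq q; rewrite ne /= -/p; have := wP q; lia.
case=> x /andP[_ /existsP[P /and5P[pP cP dP wp /forallP wq]]].
exists P; apply/and4P; split=> //; apply/forallP => q; have := wq q.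
move: wp; rewrite !cap_last -/p eqxx subn0; have := ltn_ord x.
by case: (q != p) => //=; lia.
Qed.
End Answer.

(** * Vertex sets as words *)

Section Words.
Variable n : nat.

Lemma bit_leq x l : odd (x %/ 2 ^ l) -> 2 ^ l <= x.
Proof. by move=> o; rewrite leqNgt; apply/negP => lt;
  rewrite divn_small in o. Qed.

(** Bit [l] is set, so the subtraction borrows nothing from the higher bits. This is how a vertex is
    deleted with the arithmetic at hand. *)
Lemma bit_clear x l v : odd (x %/ 2 ^ l) ->
  odd ((x - 2 ^ l) %/ 2 ^ v) = (v != l) && odd (x %/ 2 ^ v).
Proof.
move=> o; have le := bit_leq o; set y := x - 2 ^ l.
have xy : x = y + 2 ^ l by rewrite subnK.
have oy : ~~ odd (y %/ 2 ^ l).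
  by move: o; rewrite xy -[X in y + X]mul1n divnDMl ?expn_gt0 // oddD addbT.
case: (ltngtP v l) => [lt|gt|->] /=; last exact: negPf.
  rewrite xy -(subnK (ltnW lt)) expnD divnDMl ?expn_gt0 // oddD oddX.
  by rewrite subn_eq0 leqNgt lt addbF.
have ev : 2 ^ v = 2 ^ l * 2 * 2 ^ (v - l.+1).
  by rewrite -expnSr -expnD subnKC.
rewrite ev !divnMA; congr (odd (_ %/ _)).
have -> : x %/ 2 ^ l = y %/ 2 ^ l + 1.
  by rewrite xy -[X in y + X]mul1n divnDMl ?expn_gt0.
by rewrite !divn2 addn1 /= uphalf_half (negPf oy).
Qed.

Lemma set_of_word_sub x (v : 'I_n) : v \in set_of_word n x ->
  set_of_word n (x - 2 ^ v) = set_of_word n x :\ v.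
Proof.
by rewrite inE => o; apply/setP => u; rewrite !inE bit_clear.
Qed.

Lemma set_of_word_full : set_of_word n (2 ^ n - 1) = [set: 'I_n].
Proof.
apply/setP => v; rewrite !inE.
have e : 2 ^ n = 2 ^ (n - v) * 2 ^ v by rewrite -expnD subnK // ltnW.
have nv : 0 < n - v by rewrite subn_gt0.
have p0 : 0 < 2 ^ v by rewrite expn_gt0.
have -> : 2 ^ n - 1 = (2 ^ (n - v) - 1) * 2 ^ v + (2 ^ v - 1).
  rewrite e mulnBl mul1n addnBA // subnK // leq_pmull // expn_gt0 //.
rewrite divnMDl // divn_small ?addn0; last by lia.
by rewrite oddB ?expn_gt0 // oddX eqn0Ngt nv.
Qed.

Lemma card_set_of_word x D : n <= D ->
  \sum_(v < D) (if v < n then odd (x %/ 2 ^ v) : nat else 0) =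
  #|set_of_word n x|.
Proof.
move=> nD; rewrite -big_mkcond.
rewrite -(big_ord_widen _ (fun v => odd (x %/ 2 ^ v) : nat) nD).
rewrite -sum1_card [RHS]big_mkcond.
by apply: eq_bigr => v _; rewrite inE; case: (odd _).
Qed.
End Words.

(** * The table *)

Local Notation Add := (Bin OpAdd).
Local Notation Sub := (Bin OpSub).
Local Notation Mul := (Bin OpMul).
Local Notation Div := (Bin OpDiv).
Local Notation Mod := (Bin OpMod).
Local Notation Eq := (Bin OpEq).
Local Notation Lt := (Bin OpLt).
Local Notation And e1 e2 := (If e1 e2 (Cst 0)).

(** [Fold] always makes [D] rounds; here and in [Sum] and [Ex] a guard on the index makes the rounds
    beyond the intended range idle. *)
Definition Pow (x : nat) : exp :=
  Fold (Cst 1) (fun i acc =>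
    If (Lt (Var i) (Var x)) (Add (Var acc) (Var acc)) (Var acc)).

Definition Sum (b : exp) (f : nat -> exp) : exp :=
  Fold (Cst 0) (fun i acc =>
    If (Lt (Var i) b) (Add (Var acc) (f i)) (Var acc)).

Definition Ex (b : exp) (f : nat -> exp) : exp :=
  Fold (Cst 0) (fun i acc =>
    If (Lt (Var i) b) (If (f i) (Cst 1) (Var acc)) (Var acc)).

Arguments Pow : simpl never.
Arguments Sum : simpl never.
Arguments Ex : simpl never.

(** * Evaluation of the derived expressions on words *)

Section Eval.
Variables (w D : nat) (oracle mu : nat -> nat).
Local Notation ev := (eval w D oracle mu).
Hypothesis w_gt0 : 1 < 2 ^ w.

Lemma nth_rcons2 (rho : seq nat) x y :
  (nth 0 (rcons (rcons rho x) y) (size rho) = x) *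
  (nth 0 (rcons (rcons rho x) y) (size rho).+1 = y) *
  (forall i, i < size rho -> nth 0 (rcons (rcons rho x) y) i = nth 0 rho i).
Proof.
split; first by rewrite !nth_rcons !size_rcons ltnS leqnn !ltnn !eqxx.
by move=> i lti; rewrite !nth_rcons size_rcons ltnS ltnW // lti.
Qed.

Lemma ev_Pow rho x : x < size rho -> nth 0 rho x <= D ->
  2 ^ nth 0 rho x < 2 ^ w -> ev rho (Pow x) = 2 ^ nth 0 rho x.
Proof.
move=> ltx leD small; rewrite /Pow /=; set y := nth 0 rho x in leD small *.
suff H k : k <= D -> iteri k (fun i acc =>
    if (nth 0 (rcons (rcons rho i) acc) (size rho)
          < nth 0 (rcons (rcons rho i) acc) x) != 0 :> nat
    then (nth 0 (rcons (rcons rho i) acc) (size rho).+1 +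
          nth 0 (rcons (rcons rho i) acc) (size rho).+1) %% 2 ^ w
    else nth 0 (rcons (rcons rho i) acc) (size rho).+1) (1 %% 2 ^ w) =
    2 ^ minn k y by rewrite H // (minn_idPr leD).
elim: k => [|k IH] kD; first by rewrite min0n modn_small.
rewrite /= IH ?(ltnW kD) // !nth_rcons2 // -/y eqb0 negbK.
case: ltnP => ky; last by congr (2 ^ _); lia.
have -> : minn k.+1 y = k.+1 by lia.
rewrite addnn -mul2n -expnS modn_small //.
by apply: leq_ltn_trans small; rewrite leq_exp2l.
Qed.

(** Congruence of the summands suffices because every addition reduces; residues can thus stand in
    for counts. *)
Lemma ev_Sum rho b f B (F : nat -> nat) : B <= D ->
  (forall x acc, ev (rcons (rcons rho x) acc) b = B) ->
  (forall x acc, x < B ->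
     ev (rcons (rcons rho x) acc) (f (size rho)) = F x %[mod 2 ^ w]) ->
  ev rho (Sum b f) = (\sum_(x < B) F x) %% 2 ^ w.
Proof.
move=> BD evb evf; rewrite /Sum /Ex /=.
suff H k : k <= D -> iteri k (fun i acc =>
    if (nth 0 (rcons (rcons rho i) acc) (size rho)
          < ev (rcons (rcons rho i) acc) b) != 0 :> nat
    then (nth 0 (rcons (rcons rho i) acc) (size rho).+1 +
          ev (rcons (rcons rho i) acc) (f (size rho))) %% 2 ^ w
    else nth 0 (rcons (rcons rho i) acc) (size rho).+1) (0 %% 2 ^ w) =
    (\sum_(x < minn k B) F x) %% 2 ^ w by rewrite H // (minn_idPr BD).
elim: k => [|k IH] kD; first by rewrite min0n big_ord0.
rewrite /= IH ?(ltnW kD) // !nth_rcons2 // evb eqb0 negbK.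
case: ltnP => ky; last by have -> : minn k.+1 B = B by lia.
have -> : minn k.+1 B = k.+1 by lia.
by rewrite big_ord_recr /= modnDml -modnDmr evf // modnDmr.
Qed.

Lemma ev_Ex rho b f B (c : 'I_B -> bool) : B <= D ->
  (forall x acc, ev (rcons (rcons rho x) acc) b = B) ->
  (forall (x : 'I_B) acc,
     (ev (rcons (rcons rho x) acc) (f (size rho)) != 0) = c x) ->
  ev rho (Ex b f) = [exists x, c x].
Proof.
move=> BD evb evf; rewrite /Sum /Ex /=.
suff H k : k <= D -> iteri k (fun i acc =>
    if (nth 0 (rcons (rcons rho i) acc) (size rho)
          < ev (rcons (rcons rho i) acc) b) != 0 :> nat
    then if ev (rcons (rcons rho i) acc) (f (size rho)) != 0 then 1 %% 2 ^ w
         else nth 0 (rcons (rcons rho i) acc) (size rho).+1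
    else nth 0 (rcons (rcons rho i) acc) (size rho).+1) (0 %% 2 ^ w) =
    [exists x : 'I_B, (x < k) && c x].
  rewrite H //; congr nat_of_bool; apply: eq_existsb => x.
  by rewrite (leq_trans (ltn_ord x)).
elim: k => [|k IH] kD.
  by rewrite /= mod0n; case: existsP => // [[x]].
rewrite /= IH ?(ltnW kD) // !nth_rcons2 // evb eqb0 negbK.
case: ltnP => ky.
  have := evf (Ordinal ky); move=> -> /=; rewrite modn_small //.
  case ck : (c _).
    by case: existsP => // [[]]; exists (Ordinal ky); rewrite /= leqnn.
  congr nat_of_bool; apply: eq_existsb => x; rewrite ltnS [x <= k]leq_eqVlt.
  case: eqP => //= xk; have -> : c x = false.
    by have -> : x = Ordinal ky by apply: val_inj.
  by rewrite andbF.
congr nat_of_bool; apply: eq_existsb => x.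
by rewrite !(leq_trans (ltn_ord x)) // ltnW.
Qed.
End Eval.

(* Environment levels; the variables 12 and above are bound locally. *)
Local Notation vD := (Var 0).
Local Notation vt := (Var 1).
Local Notation vn := (Var 2).
Local Notation vm := (Var 3).
Local Notation vp := (Var 4).
Local Notation vP := (Var 5).
Local Notation vS := (Var 6).
Local Notation vr := (Var 7).
Local Notation vj := (Var 8).
Local Notation va := (Var 9).
Local Notation vT := (Var 10).
Local Notation vB := (Var 11).

(* The index of a cell encodes [(T, a, j, r, S)], see [table_index]. *)
Definition prelude (body : exp) : exp :=
  Let (Ld (Cst 0)) (fun _ => Let (Ld (Cst 1)) (fun _ => Let (Ld (Cst 2)) (fun _
    =>
  Let (Pow 2) (fun _ => Let (Mod vt vP) (fun _ =>
  Let (Mod (Div vt vP) vD) (fun _ => Let (Mod (Div (Div vt vP) vD) vD) (fun _ =>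
  Let (Mod (Div (Div (Div vt vP) vD) vD) vD) (fun _ =>
  Let (Div (Div (Div (Div vt vP) vD) vD) vD) (fun _ =>
  Let (Add (Cst 4) (Add (Mul vn vn) (Mul vn vm))) (fun _ => body)))))))))).

Definition table_exp (T a j r S : exp) : exp :=
  Ld (Add vB (Add (Mul (Add (Mul (Add (Mul (Add (Mul T vD) a) vD) j) vD) r) vP)
    S)).

Definition bit_exp (v : nat) : exp := Mod (Div vS (Pow v)) (Cst 2).

Definition card_exp : exp := Sum vn bit_exp.

(** The recursion of [district_rec]. The smaller set is looked up by its word alone, that is, in the
    cell whose other digits are all 0. *)
Definition district_exp : exp :=
  If (Eq card_exp (Cst 1)) (Cst 1)
    (Ex vn (fun v => And (bit_exp v) (And (Ld (Add vB (Sub vS (Pow v))))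
      (Ex vn (fun u => And (bit_exp u)
        (Ld (Add (Cst 4) (Add (Mul (Var u) vn) (Var v))))))))).

Definition prev_exp : exp := Sub vT (Cst 1).
(** The layers of a slot: [n + 1] for the zeta transform with its start, one product and [n] Moebius
    steps. *)
Definition L_exp : exp := Add (Add vn vn) (Cst 2).
Definition n1_exp : exp := Add vn (Cst 1).

Definition zeta_step (l : nat) : exp :=
  Let (Sub (Var l) (Cst 1)) (fun v =>
    Add (table_exp prev_exp va vj vr vS)
        (If (bit_exp v) (table_exp prev_exp va vj vr (Sub vS (Pow v))) (Cst
          0))).

Definition mobius_step (l : nat) : exp :=
  Let (Sub (Var l) (Add vn (Cst 2))) (fun v =>
    Sub (table_exp prev_exp va vj vr vS)
        (If (bit_exp v) (table_exp prev_exp va vj vr (Sub vS (Pow v))) (Cst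
          0))).

Definition product_step : exp :=
  Sum (Add vr (Cst 1)) (fun i =>
    Mul (table_exp prev_exp va vj (Var i) vS) (table_exp prev_exp va n1_exp
      (Sub vr (Var i)) vS)).

(** [prev_exp] is the last Moebius layer of the preceding slot, meaningful because [r] is the size
    of the set here; [Sub vT L_exp] is the start layer of that slot, which stores solvability
    itself. *)
Definition slot_step (s : nat) : exp :=
  Let (Sub (Var s) (Cst 1)) (fun s1 =>
  Let (Div (Var s1) vn) (fun q => Let (Mod (Var s1) vn) (fun i =>
    If (And (Lt (Add (Var i) (Sub (Cst 1) (Eq (Var q) vp))) va)
            (And vj (table_exp prev_exp va (Sub vj (Cst 1)) vr vS)))
       (Cst 1)
       (If (And (Eq (Var q) vp) (Lt (Var i) va)) (Cst 0)
           (table_exp (Sub vT L_exp) va vj vr vS))))).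

Definition start_step (s : nat) : exp :=
  If (Eq card_exp vr)
    (If (Eq vj n1_exp) (And (Ld (Add vB vS)) (Eq (Qry vS) (Div (Var s) vn)))
       (If (Lt vj n1_exp)
          (If (Var s) (slot_step s) (And (Eq vj (Cst 0)) (Eq vr (Cst 0))))
          (Cst 0)))
    (Cst 0).

Definition layer_exp : exp :=
  Let (Div prev_exp L_exp) (fun s => Let (Mod prev_exp L_exp) (fun l =>
    If (Eq (Var l) (Cst 0)) (start_step s)
      (If (Lt (Var l) n1_exp) (zeta_step l)
         (If (Eq (Var l) n1_exp) product_step (mobius_step l))))).

Definition cell_exp : exp := prelude (If vT layer_exp district_exp).

Definition address_exp : exp := prelude (Add vB vt).

(** There are [L] layers for each of the [m * n] slots. The 2 accounts for the layer of districts at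
    the bottom and for the start layer of slot [m * n], from which the answer is read. *)
Definition limit_exp : exp :=
  prelude (Lt vt (Mul (Add (Mul (Mul vm vn) L_exp) (Cst 2))
                      (Mul (Mul (Mul vD vD) vD) vP))).

Definition answer_exp : exp :=
  prelude (Ex vn (fun x => And (Lt (Ld (Cst 3)) n1_exp)
    (table_exp (Add (Cst 1) (Mul (Mul vm vn) L_exp)) (Add (Var x) (Cst 1)) (Ld
      (Cst 3)) vn
         (Sub vP (Cst 1))))).

Opaque Pow Sum Ex.

Lemma nth_allpairs (A B C : Type) (a0 : A) (b0 : B) (c0 : C) (f : A -> B -> C)
    (s : seq A) (t : seq B) i j : i < size s -> j < size t ->
  nth c0 [seq f x y | x <- s, y <- t] (i * size t + j) =
  f (nth a0 s i) (nth b0 t j).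
Proof.
move=> + jt; elim: s i => [|x s IH] // [|i] /= lti.
  by rewrite nth_cat size_map jt (nth_map b0).
by rewrite nth_cat size_map mulSn -addnA ltnNge leq_addr /= addKn IH.
Qed.

Lemma ltn_pair (n : nat) (u v : 'I_n) : u * n + v < n * n.
Proof.
apply: (@leq_trans (u.+1 * n)); last by rewrite leq_mul2r ltn_ord orbT.
by rewrite mulSn addnC ltn_add2r.
Qed.

(** * Contents of the table and correctness of each cell *)

Section Cells.
Variables (n m : nat) (I : wgm n m) (eta : {set 'I_n} -> 'I_m) (w : nat).
Let D := n + m + 2.
Let P := 2 ^ n.
Let L := n + n + 2.
Let W := D * D * D * P.
Let base := 4 + (n * n + n * m).
Let N := (m * n * L + 2) * W.

(* Level [n.+1] of [j] holds the second factor of the convolutions. *)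
Definition family (s a j : nat) : pred {set 'I_n} := fun A =>
  if j == n.+1 then district I A && (eta A == s %/ n :> nat)
  else (j < n.+1) && solvable I eta s a j A.

(* Layers [0 .. n] of slot [s] are the zeta transforms, layer [n.+1] is their
   product and layers [n.+1 .. n + n + 1] are its Moebius inversion. *)
Definition layer_count (s l a j r : nat) (S : {set 'I_n}) : nat :=
  if l <= n then num_between (ranked (family s a j) r) id (fun u => l <= u) S
  else num_between (ranked_pair (family s a j) (family s a n.+1) r)
    (@pair_cover n)
             (fun u => u < l - n.+1) S.

Lemma zeta_count s a j r (v : 'I_n) S :
  layer_count s v.+1 a j r S = layer_count s v a j r S +
    (if v \in S then layer_count s v a j r (S :\ v) else 0).
Proof.
rewrite /layer_count ltn_ord ltnW ?ltn_ord //.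
rewrite (@num_between_split _ _ _ _ _ v) ?ltnn //.
have e : predU1 v (fun u : 'I_n => v < u) =1 (fun u => v <= u).
  by move=> u /=; rewrite [v <= u]leq_eqVlt eq_sym.
by rewrite !(eq_num_between _ _ _ e).
Qed.

Lemma mobius_count s a j r (v : 'I_n) S :
  layer_count s (n.+1 + v) a j r S =
    (if v \in S then layer_count s (n.+1 + v) a j r (S :\ v) else 0) +
    layer_count s (n.+1 + v.+1) a j r S.
Proof.
have low k : (n.+1 + k <= n) = false by lia.
rewrite /layer_count !low !addKn addnC.
have e : predU1 v (fun u : 'I_n => u < v) =1 (fun u => u < v.+1).
  by move=> u; rewrite [RHS]ltnS [RHS]leq_eqVlt.
rewrite (@num_between_split _ _ _ _ _ v) ?ltnn // !(eq_num_between _ _ _ e);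
  congr (_ + _).
(* [S :\ v] avoids [v], so requiring agreement at [v] as well changes nothing there; this leaves
   only the previous layer besides the one sought. *)
case: ifP => // _; rewrite [RHS](@num_between_split _ _ _ _ _ v) ?ltnn //.
by rewrite !(eq_num_between _ _ _ e) !inE eqxx addn0.
Qed.

Lemma product_count s a j r S :
  layer_count s n.+1 a j r S =
  \sum_(i < r.+1) layer_count s n a j i S * layer_count s n a n.+1 (r - i) S.
Proof.
rewrite /layer_count ltnn leqnn subnn (@eq_num_between _ _ _ _ _ pred0) //
  num_between_pairs.
by apply: eq_bigr => i _; rewrite !(@eq_num_between _ _ _ _ (fun u => n <= u)
  pred0) // => u;
  rewrite leqNgt ltn_ord.
Qed.

Lemma start_count s a j r S : layer_count s 0 a j r S = ranked (family s a j) r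
  S.
Proof.
rewrite /layer_count /= (@eq_num_between _ _ _ _ _ predT) // num_betweenT.
case q : (ranked _ _ _); [rewrite -[RHS](cards1 S);
  apply: eq_card | apply: eq_card0];
  move=> A; rewrite !inE; case: eqP => [->|]; rewrite ?andbT ?andbF ?q //.
Qed.

Definition table_value (T a j r x : nat) : nat :=
  if T is T'.+1 then
    layer_count (T' %/ L) (T' %% L) a j r (set_of_word n x) %% 2 ^ w
  else district I (set_of_word n x).

(** Mixed radix with [T] leading, so that each layer is complete before the next one begins; the set
    comes last, so that district cells find smaller words already done. *)
Definition table_index (T a j r x : nat) : nat := (((T * D + a) * D + j) * D +
  r) * P + x.

Definition cell_value (t : nat) : nat :=
  table_value (t %/ P %/ D %/ D %/ D) (t %/ P %/ D %/ D %% D) (t %/ P %/ D %% D)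
        (t %/ P %% D) (t %% P).

Hypothesis room : base + N < 2 ^ w.

Lemma m_gt0 : 0 < m. Proof. exact: leq_ltn_trans (ltn_ord (favourite I)). Qed.
Lemma P_gt0 : 0 < P. Proof. by rewrite expn_gt0. Qed.
Lemma D_ge3 : 2 < D. Proof. by have := m_gt0; rewrite /D; lia. Qed.

Lemma table_indexK T a j r x : a < D -> j < D -> r < D -> x < P ->
  [/\ table_index T a j r x %/ P %/ D %/ D %/ D = T,
      table_index T a j r x %/ P %/ D %/ D %% D = a,
      table_index T a j r x %/ P %/ D %% D = j,
      table_index T a j r x %/ P %% D = r & table_index T a j r x %% P = x].
Proof.
move=> aD jD rD xP; have D0 : 0 < D by apply: leq_ltn_trans aD.
rewrite /table_index modnMDl divnMDl ?P_gt0 // (divn_small xP) addn0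
  (modn_small xP).
rewrite modnMDl divnMDl // (divn_small rD) addn0 (modn_small rD).
rewrite modnMDl divnMDl // (divn_small jD) addn0 (modn_small jD).
by rewrite modnMDl divnMDl // (divn_small aD) addn0 (modn_small aD).
Qed.

Lemma cell_value_index T a j r x : a < D -> j < D -> r < D -> x < P ->
  cell_value (table_index T a j r x) = table_value T a j r x.
Proof.
move=> aD jD rD xP; rewrite /cell_value.
by have [-> -> -> -> ->] := table_indexK T aD jD rD xP.
Qed.

Lemma index_bounds T a j r x : a < D -> j < D -> r < D -> x < P ->
  T * W <= table_index T a j r x < T.+1 * W.
Proof.
have digit A B k y z : A <= y < B -> z < k -> A * k <= y * k + z < B * k.
  move=> /andP[Ay yB] zk; rewrite (leq_trans (leq_mul Ay (leqnn k))) ?leq_addr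
    //=.
  apply: (@leq_trans (y.+1 * k)); first by rewrite mulSn addnC ltn_add2r.
  by rewrite leq_mul.
move=> aD jD rD xP; rewrite /W !mulnA /table_index;
  do 4![apply: (digit _ _ _ _ _) => //].
by rewrite leqnn ltnSn.
Qed.

Lemma index_lt T a j r x T' a' j' r' x' :
  a < D -> j < D -> r < D -> x < P -> a' < D -> j' < D -> r' < D -> x' < P ->
  T' < T -> table_index T' a' j' r' x' < table_index T a j r x.
Proof.
move=> aD jD rD xP aD' jD' rD' xP' TT.
have /andP[le _] := index_bounds T aD jD rD xP.
have /andP[_ lt] := index_bounds T' aD' jD' rD' xP'.
by apply: leq_trans lt (leq_trans _ le); rewrite leq_mul2r TT orbT.
Qed.

(** [N] is at least [2 * W], and each copy of [W] absorbs one summand; the 9 is what [D >= 3] yields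
    in [9 * D <= D * D * D]. The bound covers the constants, digits and vertex sets that the
    expressions handle. *)
Lemma small_word x : x <= 9 * D + P -> x < 2 ^ w.
Proof.
move=> le; apply: leq_ltn_trans room; apply: leq_trans le _.
have := D_ge3; have := P_gt0; rewrite /N /W => P0 D3.
have h1 : 27 <= D * D * D by nia.
have h2 : 9 * D <= D * D * D by nia.
have h3 : D * D * D <= D * D * D * P by rewrite leq_pmulr.
have h4 : P <= D * D * D * P by rewrite leq_pmull //; lia.
rewrite mulnDl; lia.
Qed.

(** Here a residue becomes a count again: at rank [#|S|] the count is at most [2 ^ n], so it is
    nonzero exactly when its residue is. *)
Lemma last_count s a j (S : {set 'I_n}) : j <= n ->
  (layer_count s (n + n + 1) a j #|S| S %% 2 ^ w != 0) =
  [exists U : {set 'I_n}, [&& U \subset S, district I U, eta U == s %/ n :> nat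
                           & solvable I eta s a j (S :\: U)]].
Proof.
move=> jn; rewrite /layer_count.
have -> : (n + n + 1 <= n) = false by lia.
rewrite (@eq_num_between _ _ _ _ _ predT); last first.
  by move=> u; rewrite (_ : n + n + 1 - n.+1 = n); [exact: ltn_ord | lia].
rewrite modn_small; last first.
  apply: leq_ltn_trans (exact_pairs_le _ _ _) _.
  by apply: small_word; rewrite leq_addl.
rewrite -lt0n exact_pairs_gt0; apply: eq_existsb => U.
by rewrite /family eqxx (ltn_eqF (jn : j < n.+1)) ltnS jn /= -andbA.
Qed.

Lemma word_sub x y : y <= x -> x < 2 ^ w -> (x + (2 ^ w - y)) %% 2 ^ w = x - y.
Proof.
move=> yx xw; have -> : x + (2 ^ w - y) = 2 ^ w + (x - y) by lia.
by rewrite modnDl modn_small //; lia.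
Qed.

(** Cancellation modulo [2 ^ w], valid even after the counts have overflowed; it carries Moebius
    inversion over to residues. *)
Lemma word_subM x y : ((x + y) %% 2 ^ w + (2 ^ w - x %% 2 ^ w)) %% 2 ^ w = y %%
  2 ^ w.
Proof.
have := ltn_pmod x (expn_gt0 2 w); have ex := divn_eq x (2 ^ w) => lt.
rewrite modnDml {1}ex; set q := x %/ _; set z := x %% _ in lt *.
have -> : q * 2 ^ w + z + y + (2 ^ w - z) = q.+1 * 2 ^ w + y by rewrite mulSn;
  lia.
by rewrite modnMDl.
Qed.

Lemma valueE s l a j r x : l < L ->
  table_value (s * L + l).+1 a j r x = layer_count s l a j r (set_of_word n x)
    %% 2 ^ w.
Proof.
move=> lL; have L0 : 0 < L by apply: leq_ltn_trans lL.
by rewrite /table_value divnMDl // divn_small // addn0 modnMDl (modn_small lL).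
Qed.

Lemma w_gt0 : 1 < 2 ^ w.
Proof. by apply: small_word; have := D_ge3; lia. Qed.

Lemma ev_prelude mu u body :
  (forall y, y < base -> mu y = nth 0 (input_seq I) y) -> u < 2 ^ w ->
  eval w D (eta_oracle eta) mu [:: D; u] (prelude body) =
  eval w D (eta_oracle eta) mu [:: D; u; n; m; favourite I : nat; P; u %% P;
    u %/ P %% D;
         u %/ P %/ D %% D; u %/ P %/ D %/ D %% D; u %/ P %/ D %/ D %/ D; base]
     body.
Proof.
move=> mu_input uw; rewrite /prelude.
have in0 : mu 0 = n by rewrite mu_input.
have in1 : mu 1 = m by rewrite mu_input.
have in2 : mu 2 = favourite I by rewrite mu_input.
have D3 := D_ge3.

rewrite /=.
rewrite !(@modn_small 1) ?(@modn_small 2) ?mod0n ?in0 ?in1 ?in2;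
  try (apply: small_word; lia).
have -> : eval w D (eta_oracle eta) mu [:: D; u; n; m;
  favourite I : nat] (Pow 2) = P.
  by rewrite ev_Pow //= ; [exact: w_gt0 | rewrite /D; lia | apply: small_word;
    lia].
congr (eval w D (eta_oracle eta) mu [:: D; u; n; m; _; P; _; _; _; _; _;
  _] body).
rewrite (modnDm (n * n)) modnDm modn_small //.
by apply: leq_ltn_trans room; apply: leq_addr.
Qed.
Lemma ev_n1_exp mu rho : nth 0 rho 2 = n ->
  eval w D (eta_oracle eta) mu rho n1_exp = n.+1.
Proof.
have := D_ge3; rewrite /= => D3 ->; rewrite (modn_small w_gt0) addn1.
by rewrite modn_small //; apply: small_word; rewrite /D; lia.
Qed.

Lemma ev_L_exp mu rho : nth 0 rho 2 = n ->
  eval w D (eta_oracle eta) mu rho L_exp = L.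
Proof.
have D3 := D_ge3; rewrite /= => ->; rewrite (@modn_small 2);
  last by apply: small_word; lia.
by rewrite modnDml modn_small //; apply: small_word; rewrite /D; lia.
Qed.

(** * Evaluation of one cell from the earlier ones *)

Section Step.
Variables (mu : nat -> nat) (T a j r x : nat).
Hypotheses (aD : a < D) (jD : j < D) (rD : r < D) (xP : x < P).
Let t := table_index T a j r x.
Hypothesis tN : t <= N.
Hypothesis mu_input : forall y, y < base -> mu y = nth 0 (input_seq I) y.
Hypothesis mu_table : forall t', t' < t -> mu (base + t') = cell_value t'.
Local Notation ev := (eval w D (eta_oracle eta) mu).
Local Notation env ext := [:: D, t, n, m, favourite I : nat, P, x, r, j, a, T,
  base & ext].
Let S := set_of_word n x.

(** The index precedes [t], so its cell is filled; as [t <= N], the address is a word, and all inner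
    reductions can be absorbed by the outermost one. *)
Lemma ev_at ext eT ea ej er eS T' a' j' r' x' :
  ev (env ext) eT = T' -> ev (env ext) ea = a' -> ev (env ext) ej = j' ->
  ev (env ext) er = r' -> ev (env ext) eS = x' ->
  a' < D -> j' < D -> r' < D -> x' < P -> table_index T' a' j' r' x' < t ->
  ev (env ext) (table_exp eT ea ej er eS) = table_value T' a' j' r' x'.
Proof.
move=> hT ha hj hr hS aD' jD' rD' xP' lt.
rewrite -(cell_value_index T' aD' jD' rD' xP') -mu_table //= hT ha hj hr hS.
(* Innermost remainders first, so that each stays under an enclosing one. *)
rewrite (modnDml (T' * D)) (modnMml (T' * D + a')).
rewrite (modnDml ((T' * D + a') * D)) (modnMml ((T' * D + a') * D + j')).
rewrite (modnDml (((T' * D + a') * D + j') * D)).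
rewrite (modnMml (((T' * D + a') * D + j') * D + r')) modnDml modnDmr.
rewrite modn_small //; by apply: leq_ltn_trans room;
  rewrite leq_add2l ltnW // (leq_trans lt).
Qed.

Lemma ev_pow ext v (v0 : nat) : v < size (env ext) -> nth 0 (env ext) v = v0 ->
  v0 <= n -> ev (env ext) (Pow v) = 2 ^ v0.
Proof.
move=> lv e le; have D3 := D_ge3.
have le2 : 2 ^ v0 <= P by rewrite leq_exp2l.
rewrite ev_Pow ?e //; [exact: w_gt0 | rewrite /D; lia | apply: small_word; lia].
Qed.

Lemma ev_bit ext v (v0 : nat) : v < size (env ext) -> nth 0 (env ext) v = v0 ->
  v0 <= n -> ev (env ext) (bit_exp v) = odd (x %/ 2 ^ v0).
Proof.
move=> lv e le; have D3 := D_ge3.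
rewrite -modn2 -(ev_pow lv e le) /= (@modn_small 2) //; apply: small_word; lia.
Qed.

Opaque bit_exp table_exp.

Lemma ev_card ext : ev (env ext) card_exp = #|S|.
Proof.
rewrite /card_exp (@ev_Sum _ _ _ _ w_gt0 _ _ _ n (fun v => odd (x %/ 2 ^ v) :
  nat)).
- have -> : \sum_(v < n) (odd (x %/ 2 ^ v) : nat) = #|S|.
    rewrite -(@card_set_of_word n x n) //.
    by apply: eq_bigr => v _; rewrite ltn_ord.
  rewrite modn_small //; apply: small_word; have := max_card S.
  by rewrite card_ord /D; lia.
- by rewrite /D; lia.
- by [].
move=> v acc ltv; congr (_ %% _); rewrite /= (ev_bit (ext := rcons (rcons ext
  v) acc) (v0 := v)) //=.
- by rewrite !size_rcons.
- by rewrite nth_rcons2.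
- exact: ltnW.
Qed.

Opaque card_exp.

Lemma mu_district y : y < t -> y < P -> mu (base + y) = district I (set_of_word
  n y).
Proof.
move=> yt yP; have D3 := D_ge3; have D0 : 0 < D by lia.
by rewrite mu_table // -[RHS]/(table_value 0 0 0 0 y) -(cell_value_index 0 D0
  D0 D0 yP).
Qed.

Lemma mu_adj (u v : 'I_n) : mu (4 + (u * n + v)) = adj I u v.
Proof.
have ltuv := ltn_pair u v.
rewrite mu_input; last by rewrite /base; lia.
have se : size (enum 'I_n) = n by rewrite size_enum_ord.
rewrite /input_seq /= nth_cat size_allpairs !se ltuv -[X in u * X]se.
by rewrite (nth_allpairs u v) ?se // !nth_ord_enum.
Qed.

Lemma ev_conn : ev (env [::]) district_exp = district I S.
Proof.
have D3 := D_ge3; have s1 : 1 < 2 ^ w := w_gt0.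
rewrite /district_exp /= ev_card (modn_small s1) district_rec eqb0 negbK.
case: (#|S| == 1) => //=.
rewrite (@ev_Ex _ _ _ _ w_gt0 _ _ _ n (fun v : 'I_n => (v \in S) &&
   (district I (S :\ v) && [exists u in S, adj I u v]))); last 2 first.
- by [].
- move=> v acc; rewrite [ev _ _]/=.
  rewrite (ev_bit (ext := [:: nat_of_ord v; acc]) (v0 := v)) //=;
    last exact: ltnW.
  rewrite eqb0 negbK (ev_pow (ext := [:: nat_of_ord v; acc]) (v0 := v)) //;
    last exact: ltnW.
  rewrite [v \in S]inE; case vS : (odd _); last by rewrite mod0n.
  rewrite [_ && _]/=.
  have vx : 2 ^ v <= x := bit_leq vS.
  have p0 : 0 < 2 ^ v by rewrite expn_gt0.
  rewrite word_sub //; last by apply: small_word; lia.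
  (* The set is the last digit of the index, so [x - 2 ^ v < x <= t] and the cell read is an earlier
     one whatever the other digits of [t] are. *)
  have tx : x <= t by rewrite /t /table_index leq_addl.
  rewrite modn_small; last by apply: leq_ltn_trans room; rewrite leq_add2l; lia.
  rewrite mu_district; [|lia|lia].
  rewrite set_of_word_sub ?inE // eqb0 negbK -/S.
  case: (district _ _); last by rewrite mod0n.
  rewrite [_ && _]/= (@ev_Ex _ _ _ _ w_gt0 _ _ _ n (fun u : 'I_n => (u \in S)
    && adj I u v)).
  - by rewrite eqb0 negbK.
  - by rewrite /D; lia.
  - by [].
  move=> u acc' /=.
  rewrite (ev_bit (ext := [:: nat_of_ord v; acc; nat_of_ord u;
    acc']) (v0 := u)) //=; last exact: ltnW.
  rewrite eqb0 negbK [u \in S]inE; case: (odd _); last by rewrite mod0n.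
  rewrite [_ && _]/= (@modn_small 4); last by apply: small_word; lia.
  rewrite (modnDml (u * n)) modnDmr modn_small;
    first by rewrite mu_adj eqb0 negbK.
  apply: leq_ltn_trans room; apply: leq_trans (leq_addr _ _).
  rewrite leq_add2l; apply: leq_trans (leq_addr _ _).
  exact: ltnW (ltn_pair u v).
- by [].
by rewrite /D; lia.
Qed.

Lemma T_word : T < 2 ^ w.
Proof.
have /andP[le _] := index_bounds T aD jD rD xP.
apply: leq_ltn_trans room; apply: leq_trans (leq_addl _ _).
apply: leq_trans tN; apply: leq_trans le; rewrite leq_pmulr //.
by have := D_ge3; rewrite /W !muln_gt0 P_gt0; lia.
Qed.

Lemma ev_prev ext : 0 < T -> ev (env ext) prev_exp = T.-1.
Proof.
by move=> T0; rewrite /= (modn_small w_gt0) word_sub ?T_word // subn1.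
Qed.

Lemma ev_n1 ext : ev (env ext) n1_exp = n.+1.
Proof. exact: ev_n1_exp. Qed.

Lemma ev_L ext : ev (env ext) L_exp = L.
Proof. exact: ev_L_exp. Qed.

Lemma ev_prev_at ext ea ej er eS a' j' r' x' : 0 < T ->
  ev (env ext) ea = a' -> ev (env ext) ej = j' -> ev (env ext) er = r' ->
  ev (env ext) eS = x' -> a' < D -> j' < D -> r' < D -> x' < P ->
  ev (env ext) (table_exp prev_exp ea ej er eS) = table_value T.-1 a' j' r' x'.
Proof.
move=> T0 *; apply: ev_at => //; first exact: ev_prev.
by apply: index_lt => //; rewrite ltn_predL.
Qed.
Opaque prev_exp n1_exp L_exp.

Lemma ev_zeta_step s (v : 'I_n) : T = (s * L + v.+1).+1 ->
  ev (env [:: s; v.+1]) (zeta_step 13) = layer_count s v.+1 a j r S %% 2 ^ w.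
Proof.
move=> eT; have vn := ltn_ord v; have D3 := D_ge3.
have T0 : 0 < T by rewrite eT.
rewrite /zeta_step /= (modn_small w_gt0) word_sub //;
  last by apply: small_word; rewrite /D; lia.
rewrite subn1 /=.
have prevE y : y < P -> table_value T.-1 a j r y = layer_count s v a j r
  (set_of_word n y) %% 2 ^ w.
  by move=> yP; rewrite eT -pred_Sn addnS valueE // /L; lia.
rewrite (ev_prev_at (ext := [:: s; v.+1; nat_of_ord v]) T0 (a' := a) (j' := j)
  (r' := r) (x' := x)) //.
rewrite (ev_bit (ext := [:: s; v.+1; nat_of_ord v]) (v0 := v)) //;
  last exact: ltnW.
rewrite zeta_count [v \in S]inE prevE // eqb0 negbK.
case vS : (odd _); last by rewrite mod0n !addn0 modn_mod.
have vx := bit_leq vS; have p0 : 0 < 2 ^ v by rewrite expn_gt0.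
have xv : x - 2 ^ v < P by lia.
rewrite (ev_prev_at (ext := [:: s; v.+1; nat_of_ord v]) T0 (a' := a) (j' := j)
  (r' := r) (x' := x - 2 ^ v)) //.
  by rewrite prevE // set_of_word_sub ?inE // modnDm.
rewrite /= (ev_pow (ext := [:: s; v.+1; nat_of_ord v]) (v0 := v)) //;
  last exact: ltnW.
by rewrite word_sub //; apply: small_word; lia.
Qed.

Lemma ev_mobius_step s (v : 'I_n) : T = (s * L + (n.+1 + v.+1)).+1 ->
  ev (env [:: s; n.+1 + v.+1]) (mobius_step 13) =
  layer_count s (n.+1 + v.+1) a j r S %% 2 ^ w.
Proof.
move=> eT; have vn := ltn_ord v; have D3 := D_ge3.
have T0 : 0 < T by rewrite eT.
rewrite /mobius_step /= (@modn_small 2); last by apply: small_word; lia.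
rewrite (@modn_small (n + 2)); last by apply: small_word; rewrite /D; lia.
rewrite (@word_sub (n.+1 + v.+1)); [|lia|by apply: small_word; rewrite /D; lia].
have -> : n.+1 + v.+1 - (n + 2) = v by lia.
set ext := [:: s; n.+1 + v.+1; nat_of_ord v].
have prevE y : y < P ->
    table_value T.-1 a j r y = layer_count s (n.+1 + v) a j r (set_of_word n y)
      %% 2 ^ w.
  move=> yP; have -> : T.-1 = (s * L + (n.+1 + v)).+1 by rewrite eT; lia.
  by rewrite valueE // /L; lia.
rewrite (ev_prev_at (ext := ext) T0 (a' := a) (j' := j) (r' := r) (x' := x)) //.
rewrite (ev_bit (ext := ext) (v0 := v)) //; last exact: ltnW.
rewrite prevE // mobius_count [v \in _]inE eqb0 negbK.
case vS : (odd _); last by have := word_subM 0 (layer_count s (n.+1 + v.+1) a j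
  r S).
have vx := bit_leq vS; have p0 : 0 < 2 ^ v by rewrite expn_gt0.
have xv : x - 2 ^ v < P by lia.
rewrite (ev_prev_at (ext := ext) T0 (a' := a) (j' := j) (r' := r) (x' := x - 2
  ^ v)) //.
  by rewrite prevE // set_of_word_sub ?inE // word_subM.
rewrite /= (ev_pow (ext := ext) (v0 := v)) //; last exact: ltnW.
by rewrite word_sub //; apply: small_word; lia.
Qed.

Lemma ev_product_step s : T = (s * L + n.+1).+1 ->
  ev (env [:: s; n.+1]) product_step = layer_count s n.+1 a j r S %% 2 ^ w.
Proof.
move=> eT; have D3 := D_ge3; have T0 : 0 < T by rewrite eT.
have prevE j' r' :
    table_value T.-1 a j' r' x = layer_count s n a j' r' S %% 2 ^ w.
  by rewrite eT -pred_Sn addnS valueE // /L; lia.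
rewrite product_count /product_step.
apply: (@ev_Sum _ _ _ _ w_gt0 _ _ _ r.+1
  (fun i => layer_count s n a j i S * layer_count s n a n.+1 (r - i) S)) => //.
  move=> i acc /=; rewrite (modn_small w_gt0) addn1.
  by rewrite modn_small //; apply: small_word; lia.
move=> i acc ir; rewrite [ev _ (Mul _ _)]/=.
set ext := [:: s; n.+1; i; acc].
rewrite (ev_prev_at (ext := ext) T0 (a' := a) (j' := j) (r' := i) (x' := x))
  //; last by lia.
rewrite (ev_prev_at (ext := ext) T0 (a' := a) (j' := n.+1) (r' := r - i) (x' :=
  x)) //.
- by rewrite !prevE modn_mod modnMm.
- exact: ev_n1.
- by rewrite /= word_sub //; apply: small_word; lia.
- by rewrite /D; have := m_gt0; lia.
- by lia.
Qed.

Lemma ev_slot_step s : T = (s.+1 * L).+1 -> #|S| = r -> j <= n -> s < m * n ->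
  ev (env [:: s.+1; 0]) (slot_step 12) = solvable I eta s.+1 a j S.
Proof.
move=> eT Sr jn smn; have D3 := D_ge3; have s1w : 1 < 2 ^ w := w_gt0.
have T0 : 0 < T by rewrite eT.
have n0 : 0 < n by case: (n) smn => //; rewrite muln0.
have qm : s %/ n < m by rewrite ltn_divLR.
have L2 : 1 < L by rewrite /L; lia.
have sw : s.+1 < 2 ^ w.
  by apply: leq_ltn_trans T_word; rewrite eT; apply: leq_trans (leqnSn _);
    rewrite leq_pmulr // ltnW.
rewrite /slot_step /= (modn_small s1w) word_sub // subn1 /=.
set ext := [:: s.+1; 0; s; s %/ n; s %% n].
have -> : (1 + (2 ^ w - (s %/ n == favourite I))) %% 2 ^ w = (s %/ n !=
  favourite I).
  by rewrite word_sub //; case: (_ == _).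
have iw : s %% n + (s %/ n != favourite I) < 2 ^ w.
  apply: small_word; have := ltn_pmod s n0; rewrite /D; case: (_ == _) => /=;
    lia.
rewrite (modn_small iw) -/(slot_open I s a) mod0n.
rewrite solvable_slot //.
have eL : T.-1 = (s * L + (n + n + 1)).+1 by rewrite eT /L; lia.
have -> : (if (slot_open I s a : nat) != 0 then
    if j != 0 then ev (env ext) (table_exp prev_exp va (Sub vj (Cst 1)) vr vS)
      else 0
   else 0) != 0 = [&& slot_open I s a, 0 < j &
        [exists U : {set 'I_n}, [&& U \subset S, district I U,
           eta U == s %/ n :> nat & solvable I eta s a j.-1 (S :\: U)]]].
  rewrite eqb0 negbK; case: (slot_open _ _ _) => //=.
  case: (posnP j) => [->|j0] //; rewrite /=.
  rewrite (ev_prev_at (ext := ext) T0 (a' := a) (j' := j.-1) (r' := r) (x' :=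
    x)) //; last by lia.
    by rewrite eL valueE ?/L; [rewrite -Sr last_count //; lia | lia].
  by rewrite /= (modn_small s1w) word_sub ?subn1 //; apply: small_word; lia.
case: ([&& _, _ & _]) => //=.
have -> : (if (s %/ n == favourite I : nat) != 0 then (s %% n < a : nat) else
  0) != 0
    = slot_forced I s a.
  by rewrite /slot_forced eqb0 negbK; case: (_ == favourite I :> nat) => //=;
    case: (s %% n < a).
case: (slot_forced _ _ _) => //=.
have eTL : T - L = (s * L + 0).+1 by rewrite eT mulSn; lia.
rewrite (ev_at (ext := ext) (T' := (s * L + 0).+1) (a' := a) (j' := j) (r' :=
  r) (x' := x)) //.
- rewrite valueE; last exact: ltnW.
  rewrite start_count /ranked /family -Sr eqxx ltnS jn ltn_eqF //.
  by case: (solvable _ _ _ _ _ _); rewrite ?mod0n ?(modn_small s1w).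
- rewrite /= ev_L word_sub ?T_word ?eTL //.
  by rewrite eT mulSn; lia.
- by apply: index_lt => //; rewrite eT ltnS addn0 ltn_mul2r ltnSn andbT ltnW.
Qed.

Opaque slot_step.

Lemma ev_start_step s : T = (s * L).+1 -> s <= m * n ->
  ev (env [:: s; 0]) (start_step 12) = layer_count s 0 a j r S %% 2 ^ w.
Proof.
move=> eT smn; have D3 := D_ge3; have s1w : 1 < 2 ^ w := w_gt0.
have bw (b : bool) : (b : nat) %% 2 ^ w = b.
  by case: b; rewrite ?mod0n ?(modn_small s1w).
rewrite start_count bw /start_step /= ev_card ev_n1 mod0n /ranked eqb0 negbK.
case: eqP => //= Sr; rewrite /family eqb0 negbK.
case: eqP => [_|jn].
  have xt : x < t.
    by apply: (@index_lt T a j r x 0 0 0 0 x) => //; rewrite ?eT //; lia.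
  rewrite modn_small; last by apply: leq_ltn_trans room;
    rewrite leq_add2l ltnW // (leq_trans xt).
  rewrite mu_district // /eta_oracle -/S eqb0 negbK.
  by case: (district _ _).
rewrite eqb0 negbK ltnS; case: (leqP j n) => //= jle.
clear bw; case: s eT smn => [|s] eT smn.
  rewrite solvable0 eqb0 negbK; case: (j == 0) => //=.
  by rewrite -cards_eq0 Sr.
by rewrite /= ev_slot_step.
Qed.

Opaque start_step zeta_step mobius_step product_step.

Lemma ev_layer s l : T = (s * L + l).+1 -> l < L -> s <= m * n ->
  ev (env [::]) layer_exp = table_value T a j r x.
Proof.
move=> eT lL smn; have D3 := D_ge3; have s1w : 1 < 2 ^ w := w_gt0.
have T0 : 0 < T by rewrite eT.
rewrite eT valueE // -eT.
have e1 : ev (env [::]) (Div prev_exp L_exp) = s.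
  rewrite [LHS]/= (ev_prev [::]) // (ev_L [::]) eT /= divnMDl ?divn_small
    ?addn0 //.
  exact: leq_ltn_trans lL.
have e2 ext : ev (env ext) (Mod prev_exp L_exp) = l.
  by rewrite [LHS]/= (ev_prev ext) // (ev_L ext) eT /= modnMDl modn_small.
rewrite /layer_exp.
transitivity (ev (env [:: s; l])
  (If (Eq (Var 13) (Cst 0)) (start_step 12)
      (If (Lt (Var 13) n1_exp) (zeta_step 13)
         (If (Eq (Var 13) n1_exp) product_step (mobius_step 13))))).
  by rewrite -[in RHS](e2 [:: s]) -{1}[in RHS]e1.
rewrite [LHS]/= mod0n ev_n1 !eqb0 !negbK.
case: l eT lL {e2} => [|l] eT lL /=.
  by apply: ev_start_step; rewrite // eT addn0.
rewrite ltnS eqSS; case: ltngtP => ln.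
- exact: (ev_zeta_step (v := Ordinal ln) eT).
- have vn : l - n.+1 < n by move: lL; rewrite /L; lia.
  have le : l.+1 = n.+1 + (Ordinal vn).+1 by rewrite /=; lia.
  by rewrite le; apply: ev_mobius_step; rewrite -le.
by rewrite ln in eT *; apply: ev_product_step.
Qed.
End Step.
Opaque layer_exp district_exp n1_exp L_exp bit_exp table_exp.

Lemma t_word t : t <= N -> t < 2 ^ w.
Proof. by move=> le; apply: leq_ltn_trans room;
  rewrite (leq_trans le) // leq_addl. Qed.

Definition mem_ok (t : nat) (mu : nat -> nat) :=
  (forall y, y < base -> mu y = nth 0 (input_seq I) y) /\
  (forall t', t' < t -> mu (base + t') = cell_value t').

Lemma ev_cell mu t : t < N -> mem_ok t mu ->
  eval w D (eta_oracle eta) mu [:: D; t] cell_exp = cell_value t.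
Proof.
move=> tN [mi mt]; rewrite /cell_exp (ev_prelude _ mi (t_word (ltnW tN)))
  /cell_value.
have D3 := D_ge3; have D0 : 0 < D by lia.
set x := t %% P; set r := _ %% D; set j := _ %% D; set a := _ %% D;
  set T := _ %/ D.
have aD : a < D by rewrite ltn_pmod.
have jD : j < D by rewrite ltn_pmod.
have rD : r < D by rewrite ltn_pmod.
have xP : x < P by rewrite ltn_pmod // P_gt0.
have et : t = table_index T a j r x by rewrite /table_index -!divn_eq.
clearbody x r j a T; subst t; rewrite [LHS]/=.
case: T tN mt => [|T] tN mt; first by rewrite [LHS]/= ev_conn //; exact: ltnW.
have L0 : 0 < L by rewrite /L; lia.
rewrite [LHS]/=; apply: (ev_layer aD jD rD xP (ltnW tN) mt (s := T %/ L) (l :=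
  T %% L)).
- by rewrite -divn_eq.
- by rewrite ltn_pmod.
(* The table ends with the start layer of slot [m * n], so [t < N] bounds the slot of the cell by
   [m * n]. *)
have /andP[le _] := index_bounds T.+1 aD jD rD xP.
have : T.+1 * W < (m * n * L + 2) * W by apply: leq_ltn_trans tN.
rewrite ltn_mul2r => /andP[_]; rewrite addn2 !ltnS => leT.
rewrite -(leq_pmul2r L0); apply: leq_trans (leq_divM _ _) leT.
Qed.

Lemma ev_address mu t : t <= N -> mem_ok 0 mu ->
  eval w D (eta_oracle eta) mu [:: D; t] address_exp = base + t.
Proof.
move=> tN [mi _]; rewrite /address_exp ev_prelude ?t_word // /=.
by rewrite modn_small //; apply: leq_ltn_trans room; rewrite leq_add2l.
Qed.

Lemma slots_word : m * n * L + 2 < 2 ^ w.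
Proof.
apply: leq_ltn_trans room; apply: leq_trans (leq_addl _ _);
  rewrite leq_pmulr //.
by have := D_ge3; rewrite /W !muln_gt0 P_gt0; lia.
Qed.

Lemma ev_limit mu t : t <= N -> mem_ok 0 mu ->
  eval w D (eta_oracle eta) mu [:: D; t] limit_exp = (t < N).
Proof.
move=> tN [mi _]; rewrite /limit_exp ev_prelude ?t_word //.
have D3 := D_ge3; have D0 : 0 < D by lia.
rewrite [LHS]/= ev_L_exp //.
rewrite (@modn_small 2); last by apply: small_word; lia.
rewrite (modnMml (m * n)) (modnDml (m * n * L)) (modnMml (D * D)).
rewrite (modnMml (D * D * D)) modnMm modn_small //.
exact: t_word.
Qed.

Opaque address_exp cell_exp.

(** Cell [t] is written at [base + t], beyond the input and apart from all earlier addresses, so no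
    value read later is ever overwritten. *)
Lemma mem_ok_fill t : t <= N ->
  mem_ok t (fillmem w (eta_oracle eta) D address_exp cell_exp (mem (input_state
    I)) t).
Proof.
elim: t => [|t IH] tN; first by split.
have [mi mt] := IH (ltnW tN); rewrite /=.
set mu := fillmem _ _ _ _ _ _ t in mi mt *.
rewrite ev_address ?(ltnW tN) ?ev_cell //.
split=> [y yb|t' t'n]; rewrite /upd.
  by rewrite ifN ?mi // neq_ltn (leq_trans yb) ?leq_addr.
rewrite eqn_add2l; case: eqP => [->//|ne]; apply: mt.
by rewrite ltn_neqAle -ltnS t'n andbT; apply/eqP.
Qed.

Lemma ev_answer mu t : t = N -> mem_ok t mu ->
  eval w D (eta_oracle eta) mu [:: D; t] answer_exp = wgm_yes I eta.
Proof.
move=> eN [mi mt]; have tN : t <= N by rewrite eN.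
rewrite /answer_exp (ev_prelude _ mi (t_word tN)).
have D3 := D_ge3; have D0 : 0 < D by lia.
have s1w : 1 < 2 ^ w := w_gt0.
set x := t %% P; set r := _ %% D; set j := _ %% D; set a := _ %% D;
  set T := _ %/ D.
have et : t = table_index T a j r x by rewrite /table_index -!divn_eq.
clearbody x r j a T; rewrite et in eN tN mt *.
rewrite wgm_yes_solvable.
rewrite (@ev_Ex _ _ _ _ w_gt0 _ _ _ n (fun y : 'I_n => (ndist I <= n) &&
   solvable I eta (m * n) y.+1 (ndist I) [set: 'I_n])); last 2 first.
- by [].
- move=> y acc; rewrite [eval _ _ _ _ _ _]/=.
  set ext := [:: nat_of_ord y; acc].
  have -> : 3 %% 2 ^ w = 3 by rewrite modn_small //; apply: small_word; lia.
  rewrite ev_n1_exp // mi // mod0n eqb0 negbK ltnS.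
  rewrite [nth 0 (input_seq I) 3]/=; case: leqP => //= kn.
  (* The cell read lies in the start layer of slot [m * n], with [r = n] the size of the full vertex
     set; no transform has acted there, so it holds solvability itself. *)
  rewrite (@ev_at mu T a j r x tN mt ext _ _ _ _ _
    (m * n * L + 0).+1 y.+1 (ndist I) n (2 ^ n - 1)).
  + rewrite valueE; last by rewrite /L; lia.
    rewrite start_count /ranked /family set_of_word_full cardsT card_ord eqxx.
    rewrite ltnS kn (ltn_eqF (kn : ndist I < n.+1)) /=.
    by case: (solvable _ _ _ _ _ _); rewrite ?mod0n ?(modn_small s1w).
  + rewrite [LHS]/= ev_L_exp // (modn_small s1w) modnMml modnDmr.
    by rewrite add1n addn0 modn_small //; apply: leq_ltn_trans slots_word; lia.
  + rewrite [LHS]/= (modn_small s1w) addn1 modn_small //.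
    by apply: small_word; have := ltn_ord y; rewrite /D; lia.
  + by rewrite [LHS]/= modn_small ?mi //; apply: small_word; lia.
  + by [].
  + by rewrite [LHS]/= (modn_small s1w) word_sub ?P_gt0 //; apply: small_word;
    rewrite leq_addl.
  + by have := ltn_ord y; rewrite /D; lia.
  + by rewrite /D; lia.
  + by rewrite /D; lia.
  + by have := P_gt0; rewrite /P; lia.
  rewrite eN /N.
  have yD : y.+1 < D by have := ltn_ord y; rewrite /D; lia.
  have kD : ndist I < D by rewrite /D; lia.
  have nD : n < D by rewrite /D; lia.
  have fP : 2 ^ n - 1 < P by have := P_gt0; rewrite /P; lia.
  have /andP[_] := index_bounds (m * n * L + 0).+1 yD kD nD fP.
  by have -> : (m * n * L + 0).+2 = m * n * L + 2 by lia.
- by [].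
by rewrite /D; lia.
Qed.

End Cells.

(** * Size of the table and the final time bound *)

Lemma table_size_le (n m : nat) : 0 < m ->
  4 + (n * n + n * m) +
  (m * n * (n + n + 2) + 2) * ((n + m + 2) * (n + m + 2) * (n + m + 2) * 2 ^ n)
    <
  4 * (2 ^ n * (n + m + 2) ^ 6).
Proof.
move=> m0; set P := 2 ^ n; set D := n + m + 2.
have P0 : 0 < P by rewrite expn_gt0.
have h1 : 4 + (n * n + n * m) <= D ^ 2.
  by rewrite expnS expn1 /D; nia.
have mn : m * n <= D * D by rewrite leq_mul // /D; lia.
have L2 : n + n + 2 <= 2 * D by rewrite /D; lia.
have D3 : 3 <= D by rewrite /D; lia.
(* Slots times layers give at most [2 * D ^ 3], and the two further layers fit into a third copy.
   With [D ^ 3] for the digits this explains the exponent 6; the input takes up the fourth copy. *)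
have h2 : m * n * (n + n + 2) + 2 <= 3 * D ^ 3.
  have := leq_mul mn L2; rewrite !expnS expn0; nia.
have h3 : D ^ 2 < D ^ 6 * P.
  apply: (@leq_trans (D ^ 6)); first by rewrite ltn_exp2l // ltnW.
  by rewrite leq_pmulr.
have h4 := leq_mul h2 (leqnn (D * D * D * P)).
have e : 3 * D ^ 3 * (D * D * D * P) = 3 * (D ^ 6 * P).
  by rewrite !expnS expn0 !muln1 !mulnA.
rewrite e in h4; rewrite (mulnC P).
set X := D ^ 6 * P in h3 h4 *.
lia.
Qed.

Theorem theorem4 :
  exists (prog : cmd) (C c : nat),
    forall (n m : nat) (I : wgm n m) (eta : {set 'I_n} -> 'I_m),
      tie_breaking I eta ->
      forall w : nat,
        word_size_ok w I (C * 2 ^ n * (n + m) ^ c) ->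
        decides_within prog w I eta (C * 2 ^ n * (n + m) ^ c).
Proof.
have [A1 [B1 H1]] := cost_poly address_exp 2.
have [A2 [B2 H2]] := cost_poly cell_exp 2.
have [A3 [B3 H3]] := cost_poly limit_exp 2.
have [A4 [B4 H4]] := cost_poly answer_exp 2.
set A := A1 + A2 + A3 + A4; set B := B1 + B2 + B3 + B4.
exists (program limit_exp address_exp cell_exp answer_exp).
(* The 4 bounds the size of the table; [2 * A + 18] is the sum of [A + 5] for a cell and [A + 13]
   for the work outside the loop; the powers of 3 come from [n + m + 2 <= 3 * (n + m)], which holds
   as [0 < m]. *)
exists (4 * (2 * A + 18) * 3 ^ (B + 6)), (B + 6) => n m I eta _ w [_ Tw].
set D := n + m + 2; set P := 2 ^ n.
set N := (m * n * (n + n + 2) + 2) * (D * D * D * P).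
have m0 : 0 < m by exact: leq_ltn_trans (ltn_ord (favourite I)).
have D0 : 0 < D by rewrite /D addn2.
have P0 : 0 < P by rewrite expn_gt0.
have DB : D ^ (B + 6) <= 3 ^ (B + 6) * (n + m) ^ (B + 6).
  by rewrite -expnMn leq_exp2r ?addn_gt0 ?orbT // /D; lia.
have NP := table_size_le n m0; rewrite -/D -/P -/N in NP.
have costs : cost D 2 address_exp + cost D 2 cell_exp + cost D 2 limit_exp +
  cost D 2 answer_exp
    <= A * D ^ B.
  have up a b : b <= B -> a * D ^ b <= a * D ^ B.
    by move=> bB; rewrite leq_mul2l leq_pexp2l ?orbT.
  rewrite /A !mulnDl !leq_add ?(leq_trans (H1 D D0)) ?(leq_trans (H2 D D0))
    ?(leq_trans (H3 D D0)) ?(leq_trans (H4 D D0)) // up // /B; lia.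
set T := _ * (n + m) ^ _ in Tw *.
have Y0 : 0 < P * D ^ 6 by rewrite muln_gt0 P0 expn_gt0 D0.
have X0 : 0 < D ^ B by rewrite expn_gt0 D0.
have TP : 4 * (2 * A + 18) * (P * D ^ 6 * D ^ B) <= T.
  have -> : P * D ^ 6 * D ^ B = P * D ^ (B + 6) by rewrite expnD mulnAC mulnA.
  have -> : T = 4 * (2 * A + 18) * (P * (3 ^ (B + 6) * (n + m) ^ (B + 6))).
    by rewrite /T !mulnA; congr (_ * _); rewrite -!mulnA (mulnC P).
  by rewrite !leq_mul.
move: (D ^ B) (P * D ^ 6) X0 Y0 TP NP costs => X Y X0 Y0 TP NP costs.
have YX : Y <= Y * X by rewrite leq_pmulr.
(* The time bound exceeds the size of input and table together, so a word that can count the steps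
   can also hold every address. *)
have room : 4 + (n * n + n * m) + N < 2 ^ w.
  apply: leq_trans Tw; apply: leq_trans TP; apply: leq_trans NP _.
  by apply: leq_mul YX; lia.
have small_D : D < 2 ^ w.
  apply: (small_word I room); apply: leq_trans (leq_addr _ _).
  by rewrite leq_pmull.
have Dmem : mem (input_state I) 0 + mem (input_state I) 1 + 2 = D by [].
have tst t : t <= N -> eval w D (eta_oracle eta)
    (fillmem w (eta_oracle eta) D address_exp cell_exp (mem (input_state I)) t)
      [:: D; t]
    limit_exp = (t < N).
  move=> tN; apply: (ev_limit (I := I)) => //;
    have [mi _] := mem_ok_fill I eta room tN.
  by split.
have [t [s [run le ans]]] :=
  program_correct small_D D0 answer_exp Dmem (leq_ltn_trans (leq_addl _ _)
    room) tst.
exists t, s; split=> //.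
  apply: leq_trans le _; apply: leq_trans TP.
  set ca := cost _ _ address_exp in costs *; set cc := cost _ _ cell_exp in
    costs *.
  set cl := cost _ _ limit_exp in costs *; set cf := cost _ _ answer_exp in
    costs *.
  have XY : X <= Y * X by rewrite leq_pmull.
  have h1 : ca + cc + cl + 5 <= (A + 5) * X by rewrite mulnDl; lia.
  have h2 : cl + cf + 13 <= (A + 13) * (Y * X).
    have := leq_mul (leqnn A) XY; rewrite mulnDl; lia.
  have NY : N <= 4 * Y by lia.
  have h3 := leq_mul NY h1; rewrite mulnACA in h3.
  rewrite -2!addnA (addnA cl); apply: leq_trans (leq_add h3 h2) _.
  by rewrite -mulnDl leq_mul //; lia.
rewrite ans (ev_answer (I := I) room erefl); last exact: mem_ok_fill.
by case: (wgm_yes _ _).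
Qed.
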